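(* Let $G$ be a circularly orderable group such that $H_1(G)$ is finitely generated free abelian and $H_2(G)$ is torsion-free. Then the tensor square $G \otimes G$ is left-orderable.
   Context: A group $G$ is left-orderable if it admits a total order $<$ such that $g_1<g_2 \Leftrightarrow hg_1<hg_2$ for all $h,g_1,g_2\in G$. A group $G$ is circularly orderable if there is a map $c: G^3\to\mathbb{Z}$ such that: (1) $c$ takes values in $\{-1,0,1\}$; (2) $c(g_1,g_2,g_3)=0$ if and only if $g_i=g_j$ for some $i\neq j$; (3) $c(g_2,g_3,g_4)-c(g_1,g_3,g_4)+c(g_1,g_2,g_4)-c(g_1,g_2,g_3)=0$ for all $g_1,\dots,g_4\in G$; (4) $c(g_1,g_2,g_3)=c(hg_1,hg_2,hg_3)$ for all $h,g_1,g_2,g_3\in G$. The (non-abelian) tensor square $G\otimes G$ is the group generated by symbols $g\otimes h$ ($g,h\in G$) subject to the relations $gh\otimes k=({}^gh\otimes{}^gk)(g\otimes k)$ and $g\otimes hk=(g\otimes h)({}^hg\otimes{}^hk)$ for all $g,h,k \in G$, where ${}^gh:=ghg^{-1}$. $H_1(G)=G_{ab}$ and $H_2(G)$ denote integral group homology with trivial action. *)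

(* Defs.v *)
From HB Require Import structures.
From mathcomp Require Import ssreflect ssrfun ssrbool eqtype choice ssrnat seq.
From mathcomp Require Import fintype bigop monoid generic_quotient.
From mathcomp Require Import ssralg ssrint matrix.
From mathcomp Require Import boolp.
From mathcomp.multinomials Require Import freeg.

Set Implicit Arguments.
Unset Strict Implicit.
Unset Printing Implicit Defensive.

Import GRing.Theory.

Local Open Scope ring_scope.
Local Open Scope quotient_scope.

Definition left_orderable (G : groupType) : Prop :=
  exists lt : rel G,
    [/\ irreflexive lt, transitive lt,
        forall x y, x != y -> lt x y || lt y x
      & forall h g1 g2, lt g1 g2 <-> lt (h * g1)%g (h * g2)%g].

Definition circularly_orderable (G : groupType) : Prop :=
  exists c : G -> G -> G -> int,
    [/\ forall g1 g2 g3, c g1 g2 g3 \in [:: -1; 0; 1],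
        forall g1 g2 g3, c g1 g2 g3 = 0 <-> [\/ g1 = g2, g1 = g3 | g2 = g3],
        forall g1 g2 g3 g4,
          c g2 g3 g4 - c g1 g3 g4 + c g1 g2 g4 - c g1 g2 g3 = 0
      & forall h g1 g2 g3, c g1 g2 g3 = c (h * g1)%g (h * g2)%g (h * g3)%g].

Section Presentation.
Variable X : choiceType.

(* The letter (x, true) stands for the generator x, and (x, false) for its
   inverse. *)
Definition word := seq (X * bool).

Definition word_inv (w : word) : word := rev [seq (l.1, ~~ l.2) | l <- w].

Variable R : word -> word -> Prop.

Inductive pres_eq : word -> word -> Prop :=
| pres_refl u : pres_eq u u
| pres_sym u v : pres_eq u v -> pres_eq v u
| pres_trans u v w : pres_eq u v -> pres_eq v w -> pres_eq u w
| pres_cat u u' v v' :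
    pres_eq u u' -> pres_eq v v' -> pres_eq (u ++ v) (u' ++ v')
| pres_cancel x b : pres_eq [:: (x, b); (x, ~~ b)] [::]
| pres_rel u v : R u v -> pres_eq u v.

Definition pres_eqb (u v : word) : bool := `[< pres_eq u v >].

Lemma pres_eqb_refl : reflexive pres_eqb.
Proof. by move=> u; apply/asboolP; apply: pres_refl. Qed.

Lemma pres_eqb_sym : symmetric pres_eqb.
Proof. by move=> u v; apply/asboolP/asboolP; apply: pres_sym. Qed.

Lemma pres_eqb_trans : transitive pres_eqb.
Proof.
by move=> v u w /asboolP uv /asboolP vw; apply/asboolP; apply: pres_trans vw.
Qed.

Canonical pres_equiv :=
  EquivRel pres_eqb pres_eqb_refl pres_eqb_sym pres_eqb_trans.

Definition presented := {eq_quot pres_eqb}.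

HB.instance Definition _ := Choice.on presented.

Definition pres_class (w : word) : presented := \pi_({eq_quot pres_eqb}) w.

Lemma pres_classP u v : pres_class u = pres_class v <-> pres_eq u v.
Proof. by split=> [/eqmodP/asboolP | uv] //; apply/eqmodP/asboolP. Qed.

Definition pres_repr (x : presented) : word := repr x.

Lemma pres_reprK : cancel pres_repr pres_class.
Proof. exact: reprK. Qed.

Definition pres_one : presented := pres_class [::].
Definition pres_mul (x y : presented) : presented :=
  pres_class (pres_repr x ++ pres_repr y).
Definition pres_inv (x : presented) : presented :=
  pres_class (word_inv (pres_repr x)).

Lemma pres_mulE u v :
  pres_mul (pres_class u) (pres_class v) = pres_class (u ++ v).
Proof.
by apply/pres_classP; apply: pres_cat; apply/pres_classP; rewrite pres_reprK.
Qed.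

Lemma pres_mulA : associative pres_mul.
Proof.
move=> x y z; rewrite -(pres_reprK x) -(pres_reprK y) -(pres_reprK z).
by rewrite !pres_mulE catA.
Qed.

Lemma pres_mul1 : left_id pres_one pres_mul.
Proof. by move=> x; rewrite -(pres_reprK x) pres_mulE. Qed.

Lemma pres_mulr1 : right_id pres_one pres_mul.
Proof. by move=> x; rewrite -(pres_reprK x) pres_mulE cats0. Qed.

Lemma word_invK : involutive word_inv.
Proof.
move=> w; rewrite /word_inv map_rev revK -map_comp -[RHS]map_id.
by apply: eq_map => -[x b] /=; rewrite negbK.
Qed.

Lemma pres_eq_mulV w : pres_eq (w ++ word_inv w) [::].
Proof.
elim: w => [|[x b] w IHw]; first exact: pres_refl.
have -> : word_inv ((x, b) :: w) = word_inv w ++ [:: (x, ~~ b)].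
  by rewrite /word_inv /= rev_cons -cats1.
apply: pres_trans (pres_cancel x b).
rewrite [X in pres_eq X _](_ : _ = [:: (x, b)] ++ (w ++ word_inv w) ++ [:: (x, ~~ b)]);
  last by rewrite -catA.
apply: (@pres_cat _ [:: (x, b)] _ [:: (x, ~~ b)]); first exact: pres_refl.
by apply: (@pres_cat _ [::]) => //; apply: pres_refl.
Qed.

Lemma pres_mulrV : right_inverse pres_one pres_inv pres_mul.
Proof.
move=> x; rewrite -{1}(pres_reprK x) pres_mulE.
by apply/pres_classP/pres_eq_mulV.
Qed.

Lemma pres_mulVr : left_inverse pres_one pres_inv pres_mul.
Proof.
move=> x; rewrite -{2}(pres_reprK x) pres_mulE; apply/pres_classP.
by rewrite -{2}(word_invK (pres_repr x)); apply: pres_eq_mulV.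
Qed.

HB.instance Definition _ := isGroup.Build presented
  pres_mulA pres_mul1 pres_mulr1 pres_mulVr pres_mulrV.

End Presentation.

Section TensorSquare.
Variable G : groupType.

(* Conjugation acts on the left here, whereas h ^ g is g^-1 * h * g in
   MathComp. *)
Definition lconj (g h : G) : G := (g * h * g^-1)%g.

Definition tsym (g h : G) : G * G * bool := ((g, h), true).

Inductive tensor_rel : word (G * G)%type -> word (G * G)%type -> Prop :=
| tensor_rell g h k :
    tensor_rel [:: tsym (g * h)%g k] [:: tsym (lconj g h) (lconj g k); tsym g k]
| tensor_relr g h k :
    tensor_rel [:: tsym g (h * k)%g] [:: tsym g h; tsym (lconj h g) (lconj h k)].

Definition tensor_square : groupType := presented tensor_rel.

End TensorSquare.

(* ker d / im d'; all of im d' lies in ker d in the complexes used below, so the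
   relation on cycles needs no such side condition. *)
Section Homology.
Variables (A B C : zmodType) (d' : {additive A -> B}) (d : {additive B -> C}).

Definition is_cycle : {pred B} := fun x => d x == 0.

Lemma is_cycle_zmod_closed : zmod_closed is_cycle.
Proof.
split=> [|x y]; rewrite !unfold_in /is_cycle ?raddf0 // => /eqP dx /eqP dy.
by rewrite raddfB dx dy subrr.
Qed.

HB.instance Definition _ := GRing.isZmodClosed.Build B is_cycle
  is_cycle_zmod_closed.

Record cycles := Cycle {cycle_val :> B; _ : is_cycle cycle_val}.
HB.instance Definition _ := [isSub for cycle_val].
HB.instance Definition _ := [Choice of cycles by <:].
HB.instance Definition _ := [SubChoice_isSubZmodule of cycles by <:].

Definition homologous (x y : cycles) : bool :=
  `[< exists a, val x - val y = d' a >].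

Lemma homologous_refl : reflexive homologous.
Proof. by move=> x; apply/asboolP; exists 0; rewrite subrr raddf0. Qed.

Lemma homologous_sym : symmetric homologous.
Proof.
by move=> x y; apply/asboolP/asboolP => -[a e]; exists (- a);
  rewrite raddfN -e opprB.
Qed.

Lemma homologous_trans : transitive homologous.
Proof.
move=> y x z /asboolP[a e] /asboolP[b f]; apply/asboolP; exists (a + b).
by rewrite raddfD -e -f addrA subrK.
Qed.

Canonical homologous_equiv :=
  EquivRel homologous homologous_refl homologous_sym homologous_trans.

Definition homology := {eq_quot homologous}.

HB.instance Definition _ := Choice.on homology.

Definition hclass (x : cycles) : homology := \pi_({eq_quot homologous}) x.
Definition hrepr (u : homology) : cycles := repr u.

Lemma hreprK : cancel hrepr hclass.
Proof. exact: reprK. Qed.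

Lemma hclassP x y : hclass x = hclass y <-> exists a, val x - val y = d' a.
Proof. by split=> [/eqmodP/asboolP | h] //; apply/eqmodP/asboolP. Qed.

Definition hadd (u v : homology) : homology := hclass (hrepr u + hrepr v).
Definition hopp (u : homology) : homology := hclass (- hrepr u).

Lemma haddE x y : hadd (hclass x) (hclass y) = hclass (x + y).
Proof.
apply/hclassP.
have /hclassP[a ea] := hreprK (hclass x).
have /hclassP[b eb] := hreprK (hclass y).
have valD u v : val (u + v : cycles) = val u + val v by exact: raddfD.
by exists (a + b); rewrite raddfD -ea -eb !valD opprD addrACA.
Qed.

Lemma haddA : associative hadd.
Proof.
by move=> u v w; rewrite -(hreprK u) -(hreprK v) -(hreprK w) !haddE addrA.
Qed.

Lemma haddC : commutative hadd.
Proof. by move=> u v; rewrite /hadd addrC. Qed.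

Lemma hadd0 : left_id (hclass 0) hadd.
Proof. by move=> u; rewrite -(hreprK u) haddE add0r. Qed.

Lemma haddN : left_inverse (hclass 0) hopp hadd.
Proof. by move=> u; rewrite -{2}(hreprK u) haddE addNr. Qed.

HB.instance Definition _ := GRing.isZmodule.Build homology
  haddA haddC hadd0 haddN.

End Homology.

Section GroupHomology.
Variable G : groupType.

(* The degrees 0 to 3 of the inhomogeneous bar complex with trivial
   coefficients in Z: degree n is the free abelian group on the symbols
   [g_1|...|g_n], the empty symbol [] being tt. *)

Definition bar_d1 : {freeg G} -> {freeg unit} :=
  fglift (fun _ : G => << tt >> - << tt >>).

Definition bar_d2 : {freeg G * G} -> {freeg G} :=
  fglift (fun p : G * G =>
    << p.2 >> - << (p.1 * p.2)%g >> + << p.1 >>).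

Definition bar_d3 : {freeg G * G * G} -> {freeg G * G} :=
  fglift (fun p : G * G * G =>
    << (p.1.2, p.2) >> - << ((p.1.1 * p.1.2)%g, p.2) >>
    + << (p.1.1, (p.1.2 * p.2)%g) >> - << (p.1.1, p.1.2) >>).

HB.instance Definition _ := GRing.isZmodMorphism.Build _ _ bar_d1
  (lift_is_additive _).
HB.instance Definition _ := GRing.isZmodMorphism.Build _ _ bar_d2
  (lift_is_additive _).
HB.instance Definition _ := GRing.isZmodMorphism.Build _ _ bar_d3
  (lift_is_additive _).

Lemma fglift_gen (K : choiceType) (M : lmodType int) (f : K -> M) (x : K) :
  fglift f << x >> = f x.
Proof. by rewrite liftU scale1r. Qed.

Lemma bar_d2E g h : bar_d2 << (g, h) >> = << h >> - << (g * h)%g >> + << g >>.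
Proof. exact: fglift_gen. Qed.

Lemma bar_d3E g h k :
  bar_d3 << (g, h, k) >> = << (h, k) >> - << ((g * h)%g, k) >>
    + << (g, (h * k)%g) >> - << (g, h) >>.
Proof. exact: fglift_gen. Qed.

Lemma bar_d2d3 (x : {freeg G * G * G}) : bar_d2 (bar_d3 x) = 0.
Proof.
rewrite -[x]freeg_sumE !raddf_sum big1 //= => -[[g h] k] _.
rewrite -[coeff _ _]intz -freegU_mulz !raddfMz.
suff /= -> : bar_d2 (bar_d3 << (g, h, k) >>) = 0 by rewrite mul0rz.
rewrite bar_d3E !raddfB raddfD raddfB /= !bar_d2E mulgA.
apply/eqP; rewrite subr_eq0 -addrA [- (_ - _ + _) + _]addrC addrA subr_eq.
rewrite addrACA [<< k >> - _ + _]addrA subrK [eqbRHS]addrC addrACA -addrA.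
by rewrite [<< h >> - _]addrC -!addrA addNKr [- _ + (<< h >> + _)]addrCA.
Qed.

(* As bar_d1 is zero, H1 G is the free abelian group on the [g] modulo
   [g * h] = [g] + [h], that is, the abelianization of G. *)
Definition H1 : zmodType := homology bar_d2 bar_d1.
Definition H2 : zmodType := homology bar_d3 bar_d2.

End GroupHomology.

Definition fg_free_abelian (V : zmodType) : Prop :=
  exists n (f : {additive 'rV[int]_n -> V}), bijective f.

Definition torsion_free (V : zmodType) : Prop :=
  forall (x : V) (n : nat), (0 < n)%N -> x *+ n = 0 -> x = 0.

(* Main.v *)
From HB Require Import structures.
Require Import Defs.
From mathcomp Require Import ssreflect ssrfun ssrbool eqtype choice ssrnat seq.
From mathcomp Require Import fintype bigop monoid generic_quotient.
From mathcomp Require Import order ssralg ssrnum ssrint matrix boolp.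
From mathcomp Require classical_sets.
From mathcomp Require Import zify.
From mathcomp.multinomials Require Import freeg.

(** Write T for the tensor square of G, d : T -> G for the homomorphism sending
    g (x) h to the commutator [g, h] = g h g^-1 h^-1, and J for ker d, which is
    central in T.

    A circular order c on G is a 2-cocycle.  Up to a coboundary, - c is twice a
    cocycle with values 0 and 1, called carry below, and the central extension
    E of G by Z defined by the latter is left-ordered: its positive elements
    are the (m, g) different from 1 with m >= 0 (circ_ext_cone).  Commutators
    in a central extension only depend on the images in G, so the rule
    g (x) h |-> [g~, h~], where g~ lifts g, defines a homomorphism u : T -> E
    over G (comm_lift).  Its kernel lies in J.  Hence T is left-orderable as
    soon as J is: order T first by its image in E and then, on ker u, by an
    order of J (positive_cone_extension).  A torsion-free abelian group is
    orderable, by Zorn's lemma (torsion_free_cone), so everything reduces to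
    showing that J has no torsion.

    Let t in J satisfy t^m = 1 with m > 0.  The argument has three steps.

    Step one uses H2.  Let M be the cokernel of d3 in the bar complex.  The
    class of [g|h] in M is the universal 2-cocycle of G, and it defines a
    central extension U of G by M.  Once the cocycle is normalized, the
    commutator map T -> U sends J into the part of M killed by d2, a copy of
    H2 G.  As H2 G is torsion-free, t goes to 1 in U (tensor_univ_torsion).

    Step two uses generators of H1.  Let W be the exterior square, the quotient
    of T by all the g (x) g.  There is a central extension K of G that contains
    W and in which every commutator [k, l] is the exterior product of the
    images of k and l (comm_ext).  It is built from W by adjoining one element
    of G at a time: if k |-> (g /\ k) k, which lifts conjugation by g, is
    viewed as an action of Z on K, then the semidirect product of K and Z is
    an extension of the same kind whose image also contains g (comm_ext_step).
    After adding representatives of a basis of H1 G, the extension maps onto G.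
    Since U is universal, K receives a map from U, and through it the map
    T -> W -> K, whose second factor is injective, factors through T -> U.
    So t goes to 1 in W (wedge_of_univ_ker), that is, t belongs to the subgroup
    generated by the elements g (x) g.

    Step three uses that H1 G is free.  The elements g (x) g are the values
    of a quadratic map on H1 G = Z^n, so each of them is the image, under a
    fixed homomorphism from matrices to J, of the matrix l(g)^T l(g), where
    l : G -> Z^n.  The homomorphism T -> M_n(Z), g (x) h |-> l(g)^T l(h)
    therefore determines the elements of that subgroup; it kills t, because
    integer matrices have no torsion, and so t = 1 (diag_span_torsion). *)

Set Implicit Arguments.
Unset Strict Implicit.
Unset Printing Implicit Defensive.

Import GRing.Theory.
Local Open Scope group_scope.

(** * Homomorphisms, conjugation and commutators *)

Section Hom.
Variables (L M : groupType) (f : L -> M).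
Hypothesis fM : {morph f : x y / x * y}.

Lemma hom1 : f 1 = 1.
Proof. by apply: (@mulgI _ (f 1)); rewrite -fM !mulg1. Qed.

Lemma homV : {morph f : x / x^-1}.
Proof. by move=> x; apply: (@mulgI _ (f x)); rewrite -fM !mulgV hom1. Qed.

Lemma homX n : {morph f : x / x ^+ n}.
Proof. by move=> x; elim: n => [|n IHn]; rewrite ?hom1 // !expgS fM IHn. Qed.

End Hom.

Section LeftConj.
Variables (G : groupType).
Implicit Types g h k : G.

(** The convention g h g^-1 h^-1 is the one that goes with the left action
    lconj; the library commutator is g^-1 h^-1 g h. *)
Definition lcomm g h : G := lconj g h * h^-1.

Lemma lconjM g h k : lconj g (h * k) = lconj g h * lconj g k.
Proof. by rewrite /lconj !gnorm. Qed.

Lemma lconjJ g h k : lconj (g * h) k = lconj g (lconj h k).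
Proof. by rewrite /lconj !gnorm. Qed.

Lemma lconj1 g : lconj 1 g = g.
Proof. by rewrite /lconj !gnorm. Qed.

Lemma lcommE g h : lcomm g h * (h * g) = g * h.
Proof. by rewrite /lcomm /lconj !gnorm. Qed.

Lemma lcommMl g h k :
  lcomm (g * h) k = lcomm (lconj g h) (lconj g k) * lcomm g k.
Proof. by rewrite /lcomm /lconj !gnorm. Qed.

Lemma lcommMr g h k :
  lcomm g (h * k) = lcomm g h * lcomm (lconj h g) (lconj h k).
Proof. by rewrite /lcomm /lconj !gnorm. Qed.

End LeftConj.

Lemma hom_lcomm (L M : groupType) (f : L -> M) :
  {morph f : x y / x * y} -> {morph f : x y / lcomm x y}.
Proof. by move=> fM x y; rewrite /lcomm /lconj !(fM, homV fM). Qed.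

(** * Presented groups *)

Section Presented.
Variables (X : choiceType) (R : word X -> word X -> Prop).

Definition pgen (x : X) : presented R := pres_class R [:: (x, true)].

Lemma pres_classM u v : pres_class R (u ++ v) = pres_class R u * pres_class R v.
Proof. by rewrite -[RHS]/(pres_mul _ _) pres_mulE. Qed.

Lemma pgenV x : pres_class R [:: (x, false)] = (pgen x)^-1.
Proof.
apply: (@mulgI _ (pgen x)); rewrite mulgV -pres_classM.
by apply/pres_classP/(@pres_cancel _ R x true).
Qed.

Lemma pres_ind (P : presented R -> Prop) :
  P 1 -> (forall x, P (pgen x)) -> (forall u, P u -> P u^-1) ->
  (forall u v, P u -> P v -> P (u * v)) -> forall u, P u.
Proof.
move=> P1 Pg PV PM u; rewrite -(pres_reprK u).
elim: (pres_repr u) => [//|[x b] w IHw].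
rewrite -cat1s pres_classM; apply: PM IHw.
by case: b; [apply: Pg | rewrite pgenV; apply/PV/Pg].
Qed.

Section Lift.
Variables (L : groupType) (f : X -> L).

Definition word_eval (w : word X) : L :=
  foldr (fun l y => (if l.2 then f l.1 else (f l.1)^-1) * y) 1 w.

Lemma word_eval_cat u v : word_eval (u ++ v) = word_eval u * word_eval v.
Proof. by elim: u => [|l u IHu] /=; rewrite ?mul1g // IHu mulgA. Qed.

Hypothesis fR : forall u v, R u v -> word_eval u = word_eval v.

Lemma word_eval_pres u v : pres_eq R u v -> word_eval u = word_eval v.
Proof.
elim=> {u v} [//|u v _ -> //|u v w _ -> _ -> //|u u' v v' _ IHu _ IHv|x b|//].
- by rewrite !word_eval_cat IHu IHv.
- by case: b => /=; rewrite mulg1 !gsimp.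
Qed.

Definition pres_lift (u : presented R) : L := word_eval (pres_repr u).

Lemma pres_lift_class w : pres_lift (pres_class R w) = word_eval w.
Proof. by apply: word_eval_pres; apply/pres_classP; rewrite pres_reprK. Qed.

Lemma pres_liftM : {morph pres_lift : u v / u * v}.
Proof.
move=> u v; rewrite -{1}(pres_reprK u) -{1}(pres_reprK v) -pres_classM.
by rewrite pres_lift_class word_eval_cat.
Qed.

Lemma pres_lift_gen x : pres_lift (pgen x) = f x.
Proof. by rewrite pres_lift_class /= mulg1. Qed.

End Lift.
End Presented.

(** * Crossed pairings: what tensor and exterior squares share *)

(** The identities below only depend on the two expansion rules, on generation
    by the tens g h and on the homomorphisms bd and act.  They are needed for
    the tensor square and for its quotient the exterior square, and this
    interface lets both have them. *)
Record pairing (G : groupType) := Pairing {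
  pgroup :> groupType;
  tens : G -> G -> pgroup;
  bd : pgroup -> G;
  act : G -> pgroup -> pgroup;
  tens_ind : forall P : pgroup -> Prop,
    P 1 -> (forall g h, P (tens g h)) -> (forall x, P x -> P x^-1) ->
    (forall x y, P x -> P y -> P (x * y)) -> forall x, P x;
  bdM : {morph bd : x y / x * y};
  bd_tens : forall g h, bd (tens g h) = lcomm g h;
  actM : forall g, {morph act g : x y / x * y};
  act_tens : forall g h k, act g (tens h k) = tens (lconj g h) (lconj g k);
  tensMl : forall g h k,
    tens (g * h) k = tens (lconj g h) (lconj g k) * tens g k;
  tensMr : forall g h k,
    tens g (h * k) = tens g h * tens (lconj h g) (lconj h k) }.

Section PairingTheory.
Variables (G : groupType) (W : pairing G).
Implicit Types (g h k l : G) (x y : W).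
Local Notation "g ▷ x" := (act g x) (at level 30, right associativity).
Local Notation "g ⊗ h" := (@tens G W g h) (at level 30).

Lemma eq_hom_tens (L : groupType) (f f' : W -> L) :
  {morph f : x y / x * y} -> {morph f' : x y / x * y} ->
  (forall g h, f (g ⊗ h) = f' (g ⊗ h)) -> f =1 f'.
Proof.
move=> fM f'M eff'; apply: tens_ind => [|//|x e|x y ex ey].
- by rewrite !hom1.
- by rewrite !homV // e.
- by rewrite fM f'M ex ey.
Qed.

Lemma act_act g h x : (g * h) ▷ x = g ▷ (h ▷ x).
Proof.
apply: (eq_hom_tens (f := act (g * h)) (f' := act g \o act h)) x.
- exact: actM.
- by move=> x y /=; rewrite !actM.
- by move=> k l; rewrite /= !act_tens !lconjJ.
Qed.

Lemma act_id x : 1 ▷ x = x.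
Proof.
apply: (eq_hom_tens (f' := id)) x => //; first exact: actM.
by move=> k l; rewrite act_tens !lconj1.
Qed.

Lemma tens_Ml g h k : (g * h) ⊗ k = g ▷ (h ⊗ k) * (g ⊗ k).
Proof. by rewrite tensMl act_tens. Qed.

Lemma tens_Mr g h k : g ⊗ (h * k) = (g ⊗ h) * h ▷ (g ⊗ k).
Proof. by rewrite tensMr act_tens. Qed.

Lemma tens1g g : 1 ⊗ g = 1.
Proof.
by apply: (@mulgI _ (1 ⊗ g)); rewrite mulg1 -{1}[1 ⊗ g]act_id -tens_Ml mul1g.
Qed.

Lemma tensg1 g : g ⊗ 1 = 1.
Proof.
by apply: (@mulgI _ (g ⊗ 1)); rewrite mulg1 -{2}[g ⊗ 1]act_id -tens_Mr mul1g.
Qed.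

(** Expanding (g h) ⊗ (k l) on the left first or on the right first gives two
    words with equal ends; cancelling the ends leaves this identity, for x the
    generator h ⊗ l.  All commutation rules in the pairing come from it. *)
Lemma tens_swap g k x : (g * k) ▷ x * (g ⊗ k) = (g ⊗ k) * (k * g) ▷ x.
Proof.
elim/tens_ind: x => [|h l|x IHx|x y IHx IHy].
- by rewrite !(hom1 (actM _)) !gsimp.
- (* both sides begin with g ▷ (h ⊗ k) and end with k ▷ (g ⊗ l) *)
  have := tens_Ml g h (k * l).
  rewrite tens_Mr [(g * h) ⊗ k]tens_Ml [(g * h) ⊗ l]tens_Ml.
  rewrite [g ⊗ (k * l)]tens_Mr [h ⊗ (k * l)]tens_Mr !actM -!act_act -!mulgA.
  by move/mulgI; rewrite !mulgA => /mulIg <-.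
- rewrite !(homV (actM _)); apply: (@mulgI _ ((g * k) ▷ x)).
  by rewrite mulgA mulgV mul1g mulgA IHx mulgK.
- by rewrite !actM -mulgA IHy mulgA IHx mulgA.
Qed.

Lemma tens_peiffer g k x : lcomm g k ▷ x = (g ⊗ k) * x * (g ⊗ k)^-1.
Proof.
have := tens_swap g k ((k * g)^-1 ▷ x).
rewrite -!act_act mulgV act_id => <-.
by rewrite mulgK /lcomm /lconj !gnorm.
Qed.

(** The Peiffer rule of crossed modules, which makes the kernel of bd
    central. *)
Lemma peiffer x y : bd x ▷ y = x * y * x^-1.
Proof.
elim/tens_ind: x y => [|g h|x IHx|x x' IHx IHx'] y.
- by rewrite (hom1 (@bdM _ W)) act_id !gsimp.
- by rewrite bd_tens tens_peiffer.
- rewrite (homV (@bdM _ W)).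
  have {2}-> : y = bd x ▷ (bd x)^-1 ▷ y by rewrite -act_act mulgV act_id.
  by rewrite IHx !gnorm.
- by rewrite bdM act_act IHx IHx' !gnorm.
Qed.

(** Write [g, h] as g times a conjugate of g^-1 and expand on the left; the
    factor g^-1 is then eliminated by expanding g g^-1 ⊗ l = 1, and the
    difference between g h and h g acts by tens_peiffer. *)
Lemma tens_comml g h k : lcomm g h ⊗ k = (g ⊗ h) * k ▷ (g ⊗ h)^-1.
Proof.
have tensV l : g ▷ (g^-1 ⊗ l) = (g ⊗ l)^-1.
  apply: (@mulIg _ (g ⊗ l)); rewrite -tens_Ml mulgV mulVg; exact: tens1g.
have -> : lcomm g h = g * lconj h g^-1 by rewrite /lcomm /lconj !gnorm.
rewrite tens_Ml.
have -> : lconj h g^-1 ⊗ k = h ▷ (g^-1 ⊗ lconj h^-1 k).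
  by rewrite act_tens -lconjJ mulgV lconj1.
have e : h ▷ (g ⊗ lconj h^-1 k) = (g ⊗ h)^-1 * (g ⊗ k) * k ▷ (g ⊗ h).
  apply: (@mulgI _ (g ⊗ h)); rewrite -tens_Mr -!mulgA mulVKg -tens_Mr.
  by rewrite /lconj !gnorm.
rewrite -act_act -[g * h]lcommE act_act [(h * g) ▷ _]act_act.
by rewrite tens_peiffer tensV (homV (actM h)) e (homV (actM k)) !gnorm.
Qed.

(** Expanding k ⊗ (g h) along g h = [g, h] (h g) reduces this to comparing
    (k g) ⊗ h with (g k) ⊗ h, hence to tens_comml. *)
Lemma tens_commr g h k : k ⊗ lcomm g h = k ▷ (g ⊗ h) * (g ⊗ h)^-1.
Proof.
apply: (@mulIg _ (lcomm g h ▷ (k ⊗ (h * g)))).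
rewrite -tens_Mr lcommE tens_peiffer !tens_Mr !gnorm.
apply: (@mulIg _ (g ⊗ h)); rewrite !gnorm.
have e : (k ⊗ g) * g ▷ (k ⊗ h) * (g ⊗ h) = k ▷ (g ⊗ h) * (k ⊗ h) * h ▷ (k ⊗ g).
  have := tens_Ml (lcomm k g) (g * k) h.
  rewrite lcommE tens_peiffer tens_comml tens_Ml (homV (actM _)) => ->.
  by rewrite tens_Ml !gnorm.
by rewrite e.
Qed.

(** Both sides are crossed homomorphisms in x, so the case of generators is
    enough. *)
Lemma tens_bdr x k : k ⊗ bd x = k ▷ x * x^-1.
Proof.
elim/tens_ind: x => [|g h|x IHx|x y IHx IHy].
- by rewrite (hom1 (@bdM _ W)) tensg1 (hom1 (actM k)) !gsimp.
- by rewrite bd_tens tens_commr.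
- apply: (@mulIg _ (bd x^-1 ▷ (k ⊗ bd x))); rewrite -tens_Mr -bdM mulVg.
  by rewrite (hom1 (@bdM _ W)) tensg1 peiffer IHx (homV (actM k)) !gnorm.
- by rewrite bdM tens_Mr peiffer IHx IHy actM !gnorm.
Qed.

(** By tens_bdr, the failure of g to fix x is g ⊗ bd x. *)
Lemma bd1_act x g : bd x = 1 -> g ▷ x = x.
Proof.
by move=> dx; apply: (@mulIg _ x^-1); rewrite -tens_bdr dx tensg1 mulgV.
Qed.

Lemma bd1_central x y : bd x = 1 -> x * y = y * x.
Proof.
by move=> dx; apply: (@mulIg _ x^-1); rewrite -peiffer dx act_id mulgK.
Qed.

End PairingTheory.

(** * The tensor square and the exterior square *)

Section PresentedPairing.
Variables (G : groupType) (R : word (G * G)%type -> word (G * G)%type -> Prop).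

Definition conj_gen (g : G) (p : G * G) : presented R :=
  pgen R (lconj g p.1, lconj g p.2).

Hypothesis tensorR : forall u v, tensor_rel u v -> R u v.
Hypothesis commR : forall u v, R u v ->
  word_eval (fun p => lcomm p.1 p.2) u = word_eval (fun p => lcomm p.1 p.2) v.
Hypothesis conjR : forall g u v, R u v ->
  word_eval (conj_gen g) u = word_eval (conj_gen g) v.

Lemma pgenMl g h k :
  pgen R (g * h, k) = pgen R (lconj g h, lconj g k) * pgen R (g, k).
Proof. by rewrite -pres_classM; apply/pres_classP/pres_rel/tensorR; left. Qed.

Lemma pgenMr g h k :
  pgen R (g, h * k) = pgen R (g, h) * pgen R (lconj h g, lconj h k).
Proof. by rewrite -pres_classM; apply/pres_classP/pres_rel/tensorR; right. Qed.

Definition presented_pairing : pairing G.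
Proof.
apply: (@Pairing G (presented R) (fun g h => pgen R (g, h))
  (pres_lift (fun p : G * G => lcomm p.1 p.2))
  (fun g => pres_lift (conj_gen g)) _ (pres_liftM commR) _
  (fun g => pres_liftM (@conjR g)) _ pgenMl pgenMr).
- by move=> P P1 Pg PV PM; apply: pres_ind => // -[g h]; apply: Pg.
- by move=> g h; rewrite pres_lift_gen.
- by move=> g h k; rewrite (pres_lift_gen (@conjR g)).
Defined.

End PresentedPairing.

Section TensorAndWedge.
Variable G : groupType.

Inductive wedge_rel : word (G * G)%type -> word (G * G)%type -> Prop :=
| wedge_tensor u v : tensor_rel u v -> wedge_rel u v
| wedge_diag g : wedge_rel [:: tsym g g] [::].

Lemma tensor_eval (L : groupType) (f : G * G -> L) :
  (forall g h k, f (g * h, k) = f (lconj g h, lconj g k) * f (g, k)) ->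
  (forall g h k, f (g, h * k) = f (g, h) * f (lconj h g, lconj h k)) ->
  forall u v, tensor_rel u v -> word_eval f u = word_eval f v.
Proof. by move=> fl fr u v [] g h k /=; rewrite !mulg1 -(fl, fr). Qed.

Lemma tensor_comm u v : @tensor_rel G u v ->
  word_eval (fun p => lcomm p.1 p.2) u = word_eval (fun p => lcomm p.1 p.2) v.
Proof. by apply: tensor_eval => g h k /=; rewrite (lcommMl, lcommMr). Qed.

Lemma tensor_conj (R : word (G * G)%type -> word (G * G)%type -> Prop) g u v :
  (forall u v, tensor_rel u v -> R u v) -> tensor_rel u v ->
  word_eval (conj_gen R g) u = word_eval (conj_gen R g) v.
Proof.
move=> tR; apply: tensor_eval => h k l; rewrite /conj_gen /= lconjM.
- by rewrite (pgenMl tR) /lconj !gnorm.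
- by rewrite (pgenMr tR) /lconj !gnorm.
Qed.

Definition tensor_pairing : pairing G :=
  presented_pairing (fun u v e => e) tensor_comm
    (fun g u v => tensor_conj g (fun u v e => e)).

Lemma wedge_comm u v : wedge_rel u v ->
  word_eval (fun p => lcomm p.1 p.2) u = word_eval (fun p => lcomm p.1 p.2) v.
Proof.
by move=> [{}u {}v /tensor_comm //|g] /=; rewrite /lcomm /lconj !gnorm.
Qed.

Lemma wedge_conj g u v : wedge_rel u v ->
  word_eval (conj_gen wedge_rel g) u = word_eval (conj_gen wedge_rel g) v.
Proof.
move=> [{}u {}v /tensor_conj|h] /=; first by apply; apply: wedge_tensor.
by rewrite mulg1; apply/pres_classP/pres_rel/wedge_diag.
Qed.

Definition wedge_pairing : pairing G :=
  presented_pairing wedge_tensor wedge_comm wedge_conj.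

Lemma tens_wedge_diag g : tens wedge_pairing g g = 1.
Proof. exact/pres_classP/pres_rel/wedge_diag. Qed.

Definition wedge_of : tensor_pairing -> wedge_pairing :=
  pres_lift (pgen wedge_rel).

Let wedge_ofR u v : @tensor_rel G u v ->
  word_eval (pgen wedge_rel) u = word_eval (pgen wedge_rel) v.
Proof.
by apply: tensor_eval; [apply: pgenMl | apply: pgenMr]; apply: wedge_tensor.
Qed.

Lemma wedge_ofM : {morph wedge_of : x y / x * y}.
Proof. exact: pres_liftM wedge_ofR. Qed.

Lemma wedge_of_tens g h : wedge_of (tens _ g h) = tens _ g h.
Proof. exact: (pres_lift_gen wedge_ofR). Qed.

(** An induction on derivations: two words that are equal in the exterior square
    differ, in the tensor square, by an element of N.  Centrality of N lets
    such differences be multiplied. *)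
Lemma wedge_ker (N : tensor_pairing -> Prop) :
  N 1 -> (forall x, N x -> N x^-1) -> (forall x y, N x -> N y -> N (x * y)) ->
  (forall x y, N x -> x * y = y * x) -> (forall g, N (tens _ g g)) ->
  forall x, wedge_of x = 1 -> N x.
Proof.
move=> N1 NV NM NC Ndiag x.
have wordE w : wedge_of (pres_class _ w) = pres_class _ w.
  rewrite /wedge_of (pres_lift_class wedge_ofR).
  elim: w => [//|[y b] w IHw] /=; rewrite IHw -cat1s pres_classM.
  by case: b; rewrite ?pgenV.
suff Neq u v : pres_eq wedge_rel u v ->
    N (pres_class (@tensor_rel G) u * (pres_class (@tensor_rel G) v)^-1).
  rewrite -(pres_reprK x) wordE => /pres_classP/Neq.
  by rewrite invg1 mulg1.
elim=> {u v} [u|u v _ IH|u v w _ IHu _ IHv|u u' v v' _ IHu _ IHv|y b|u v].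
- by rewrite mulgV.
- by move: (NV _ IH); rewrite invgM invgK.
- by move: (NM _ _ IHu IHv); rewrite !gnorm.
- rewrite !pres_classM; set U := pres_class _ u; set U' := pres_class _ u'.
  set V := pres_class _ v; set V' := pres_class _ v'.
  have -> : U * V * (U' * V')^-1 = U * U'^-1 * (U' * (V * V'^-1) * U'^-1).
    by rewrite !gnorm.
  by rewrite -(NC _ U' IHv) mulgK; apply: NM.
- have -> : pres_class (@tensor_rel G) [:: (y, b); (y, ~~ b)] = 1.
    exact/pres_classP/pres_cancel.
  by rewrite mulgV.
- case=> [{}u {}v uv|g]; last by rewrite invg1 mulg1; apply: Ndiag.
  have -> : pres_class (@tensor_rel G) u = pres_class (@tensor_rel G) v.
    exact/pres_classP/pres_rel.
  by rewrite mulgV.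
Qed.

End TensorAndWedge.

(** * Central extensions and the commutator map *)

(** Bundling the centrality of the kernel is what allows the kernel, the type
    cker below, to carry a canonical abelian group structure. *)
Record central_hom (L G : groupType) := CentralHom {
  cfun :> L -> G;
  cfunM : {morph cfun : x y / x * y};
  cfunC : forall z x, cfun z = 1 -> z * x = x * z }.

Section CommLift.
Variables (L G : groupType) (p : central_hom L G) (s : G -> L).
Hypothesis sK : cancel s p.

(** A central factor cancels from a commutator. *)
Lemma lcomm_fiber x x' y y' : p x = p x' -> p y = p y' -> lcomm x y = lcomm x' y'.
Proof.
have fiberE u v : p u = p v -> exists2 z, u = z * v & forall w, z * w = w * z.
  move=> e; exists (u * v^-1); first by rewrite !gnorm.
  by move=> w; apply: (cfunC (c := p)); rewrite cfunM (homV (@cfunM _ _ p)) e mulgV.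
move=> /fiberE[z -> zC] /fiberE[t -> tC]; rewrite /lcomm /lconj.
rewrite zC -(mulgA x' z) zC !invgM !gnorm -(tC x') -!mulgA tC.
by rewrite !mulgA mulgVK.
Qed.

Definition comm_lift : tensor_pairing G -> L :=
  pres_lift (fun q : G * G => lcomm (s q.1) (s q.2)).

Let commR u v : @tensor_rel G u v ->
  word_eval (fun q => lcomm (s q.1) (s q.2)) u =
  word_eval (fun q => lcomm (s q.1) (s q.2)) v.
Proof.
apply: tensor_eval => g h k /=.
- rewrite (@lcomm_fiber (s (g * h)) (s g * s h) (s k) (s k)) //.
    rewrite lcommMl; congr (_ * _); apply: lcomm_fiber;
    by rewrite /lconj !(cfunM, homV (@cfunM _ _ p), sK).
  by rewrite cfunM !sK.
- rewrite (@lcomm_fiber (s g) (s g) (s (h * k)) (s h * s k)) //.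
    rewrite lcommMr; congr (_ * _); apply: lcomm_fiber;
    by rewrite /lconj !(cfunM, homV (@cfunM _ _ p), sK).
  by rewrite cfunM !sK.
Qed.

Lemma comm_liftM : {morph comm_lift : x y / x * y}.
Proof. exact: pres_liftM commR. Qed.

Lemma comm_lift_tens g h : comm_lift (tens _ g h) = lcomm (s g) (s h).
Proof. exact: pres_lift_gen. Qed.

Lemma bd_comm_lift x : p (comm_lift x) = bd x.
Proof.
apply: (eq_hom_tens (f := p \o comm_lift)) x.
- by move=> x y; rewrite /comp comm_liftM cfunM.
- exact: bdM.
- move=> g h; rewrite /comp comm_lift_tens (hom_lcomm (@cfunM _ _ p)) !sK.
  by rewrite bd_tens.
Qed.

End CommLift.

(** * Extensions whose commutators are exterior products *)

Section IntPower.
Variables (G : groupType) (g : G).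

Definition zpow (m : int) : G :=
  match m with Posz n => g ^+ n | Negz n => (g ^+ n.+1)^-1 end.

Lemma zpow_succ m : zpow (m + 1)%R = zpow m * g.
Proof.
case: m => [n|[|n]].
- by rewrite -PoszD addn1 /= expgSr.
- by rewrite /= mulVg.
- have -> : (Negz n.+1 + 1)%R = Negz n by lia.
  by rewrite /= [g ^+ n.+2]expgS invgM mulgVK.
Qed.

Lemma zpowD m n : zpow (m + n)%R = zpow m * zpow n.
Proof.
elim: n => [|n IHn|n IHn]; first by rewrite addr0 mulg1.
- by rewrite -addn1 PoszD addrA !zpow_succ IHn mulgA.
- apply: (@mulIg _ g); rewrite -mulgA -!zpow_succ.
  have -> : (m - n.+1%:Z + 1 = m - n%:Z)%R by lia.
  by have -> : (- n.+1%:Z + 1 = - n%:Z)%R by lia.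
Qed.

Lemma zpow_ind (P : G -> Prop) : P 1 -> P g -> (forall x, P x -> P x^-1) ->
  (forall x y, P x -> P y -> P (x * y)) -> forall m, P (zpow m).
Proof.
move=> P1 Pg PV PM.
have Pn n : P (g ^+ n) by elim: n => [//|n IHn]; rewrite expgS; apply: PM.
by case=> n; [apply: Pn | apply/PV/Pn].
Qed.

End IntPower.

(** An extension of a subgroup of G, containing W as a subgroup over G, in which
    [x, y] is the pairing of the images of x and y.  Surjectivity of ce_proj is
    left out so that such extensions can be enlarged step by step, starting
    from W itself. *)
Record comm_ext (G : groupType) (W : pairing G) := CommExt {
  ce_group :> groupType;
  ce_proj : ce_group -> G;
  ce_inj : W -> ce_group;
  ce_projM : {morph ce_proj : x y / x * y};
  ce_injM : {morph ce_inj : x y / x * y};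
  ce_inj_inj : injective ce_inj;
  ce_proj_inj : forall t, ce_proj (ce_inj t) = bd t;
  ce_conj : forall x t, x * ce_inj t = ce_inj (act (ce_proj x) t) * x;
  ce_swap : forall x y,
    x * y = ce_inj (tens W (ce_proj x) (ce_proj y)) * (y * x) }.

Section CommExtSelf.
Variables (G : groupType) (W : pairing G).
Let idM : {morph @id W : x y / x * y}. Proof. by []. Qed.
Let conj_self (x t : W) : x * t = act (bd x) t * x.
Proof. by rewrite peiffer !gnorm. Qed.
Let swap_self (x y : W) : x * y = tens W (bd x) (bd y) * (y * x).
Proof. by rewrite tens_bdr peiffer !gnorm. Qed.

Definition comm_ext_self : comm_ext W :=
  CommExt (@bdM _ W) idM (fun x y e => e) (fun t => erefl) conj_self swap_self.

End CommExtSelf.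

Section WedgeIdentities.
Variables (G : groupType) (W : pairing G).
Hypothesis diagW : forall g, tens W g g = 1.
Local Notation "g ▷ x" := (act g x) (at level 30, right associativity).
Local Notation "g ⊗ h" := (@tens G W g h) (at level 30).

(** Expand (g h) ⊗ (g h) = 1. *)
Lemma wedge_alt g h : (h ⊗ g) * (g ⊗ h) = 1.
Proof.
have := diagW (g * h); rewrite tens_Ml !tens_Mr !diagW hom1 ?mulg1 ?mul1g.
  by rewrite -actM => e; rewrite -[LHS](act_id) -(mulVg g) act_act e hom1 //; apply: actM.
exact: actM.
Qed.

Lemma wedge_zpow g m n : zpow g m ⊗ zpow g n = 1.
Proof.
move: m; apply: (zpow_ind (P := fun x => x ⊗ zpow g n = 1)).
- exact: tens1g.
- move: n; apply: (zpow_ind (P := fun y => g ⊗ y = 1)).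
  + exact: tensg1.
  + exact: diagW.
  + move=> y gy; have := tens_Mr W g y^-1 y.
    by rewrite mulVg gy tensg1 (hom1 (actM _)) mulg1.
  + by move=> x y gx gy; rewrite tens_Mr gx gy mul1g (hom1 (actM _)).
- move=> x xg; have := tens_Ml W x^-1 x (zpow g n).
  by rewrite mulVg xg tens1g (hom1 (actM _)) mul1g.
- by move=> x y xg yg; rewrite tens_Ml xg yg mulg1 (hom1 (actM _)).
Qed.

End WedgeIdentities.

(** * Adjoining an element *)

(** The semidirect product of K with the integers, m acting as ce_act (g^m).
    When the image of K already contains a power of g, the kernel of the
    projection to G grows; this is harmless, as it stays central. *)
Definition step_group (G : groupType) (W : pairing G) (K : comm_ext W) (g : G)
  : Type := (K * int)%type.
HB.instance Definition _ G (W : pairing G) (K : comm_ext W) g :=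
  Choice.copy (step_group K g) (K * int)%type.

Section CommExtStep.
Variables (G : groupType) (W : pairing G).
Hypothesis diagW : forall g, tens W g g = 1.
Variables (K : comm_ext W) (g : G).
Local Notation "g ▷ x" := (act g x) (at level 30, right associativity).
Local Notation "g ⊗ h" := (@tens G W g h) (at level 30).
Local Notation pi := (@ce_proj G W K).
Local Notation iota := (@ce_inj G W K).

(** The lift to K of conjugation by a.  For a = ce_proj l it is conjugation
    by l; the point is that it exists for every a in G. *)
Definition ce_act (a : G) (k : K) : K := iota (a ⊗ pi k) * k.

Lemma pi_ce_act a k : pi (ce_act a k) = lconj a (pi k).
Proof.
by rewrite /ce_act ce_projM ce_proj_inj bd_tens /lcomm /lconj !gnorm.
Qed.

Lemma ce_actM a : {morph ce_act a : x y / x * y}.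
Proof.
move=> x y; rewrite /ce_act ce_projM tens_Mr ce_injM -!mulgA; congr (_ * _).
by rewrite !mulgA -ce_conj.
Qed.

(** Write the conjugate of pi k by b as [b, pi k] (pi k) and use tens_commr. *)
Lemma ce_act_act a b k : ce_act (a * b) k = ce_act a (ce_act b k).
Proof.
rewrite {2}/ce_act pi_ce_act /ce_act mulgA -ce_injM; congr (iota _ * _).
have -> : lconj b (pi k) = lcomm b (pi k) * pi k by rewrite /lcomm !gnorm.
by rewrite tens_Mr tens_commr tens_peiffer tens_Ml !gnorm.
Qed.

Lemma ce_act_inj a t : ce_act a (iota t) = iota (a ▷ t).
Proof. by rewrite /ce_act ce_proj_inj tens_bdr -ce_injM mulgVK. Qed.

Lemma ce_act1 k : ce_act 1 k = k.
Proof. by rewrite /ce_act tens1g (hom1 (@ce_injM _ _ K)) mul1g. Qed.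

Definition step_mul (x y : step_group K g) : step_group K g :=
  (x.1 * ce_act (zpow g x.2) y.1, (x.2 + y.2)%R).
Definition step_one : step_group K g := (1, 0%R).
Definition step_inv (x : step_group K g) : step_group K g :=
  (ce_act (zpow g (- x.2)%R) x.1^-1, (- x.2)%R).

Lemma step_mulA : associative step_mul.
Proof.
move=> x y z; rewrite /step_mul /= addrA zpowD ce_act_act.
by rewrite !ce_actM mulgA.
Qed.

Lemma step_mul1 : left_id step_one step_mul.
Proof. by case=> k m; rewrite /step_mul /= mul1g ce_act1 add0r. Qed.

Lemma step_mulr1 : right_id step_one step_mul.
Proof.
by case=> k m; rewrite /step_mul /= (hom1 (ce_actM _)) mulg1 addr0.
Qed.

Lemma step_mulVr : left_inverse step_one step_inv step_mul.
Proof.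
case=> k m; rewrite /step_mul /= addNr -ce_actM mulVg.
by rewrite (hom1 (ce_actM _)).
Qed.

Lemma step_mulrV : right_inverse step_one step_inv step_mul.
Proof.
case=> k m; rewrite /step_mul /= addrN -ce_act_act -zpowD addrN ce_act1.
by rewrite mulgV.
Qed.

HB.instance Definition _ := isGroup.Build (step_group K g)
  step_mulA step_mul1 step_mulr1 step_mulVr step_mulrV.

Definition step_proj (x : step_group K g) : G := pi x.1 * zpow g x.2.
Definition step_inj (t : W) : step_group K g := (iota t, 0%R).

Lemma step_mulE (x y : step_group K g) :
  x * y = (x.1 * ce_act (zpow g x.2) y.1, (x.2 + y.2)%R).
Proof. by []. Qed.

Lemma step_projM : {morph step_proj : x y / x * y}.
Proof.
move=> x y; rewrite step_mulE /step_proj /= ce_projM pi_ce_act zpowD.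
by rewrite /lconj !gnorm.
Qed.

Lemma step_injM : {morph step_inj : x y / x * y}.
Proof.
by move=> x y; rewrite step_mulE /step_inj /= ce_act1 ce_injM addr0.
Qed.

Lemma step_inj_inj : injective step_inj.
Proof. by move=> x y [/ce_inj_inj]. Qed.

Lemma step_proj_inj t : step_proj (step_inj t) = bd t.
Proof. by rewrite /step_proj /= mulg1 ce_proj_inj. Qed.

Lemma step_conj x t : x * step_inj t = step_inj (step_proj x ▷ t) * x.
Proof.
rewrite !step_mulE /= ce_act1 ce_act_inj addr0 add0r ce_conj -act_act.
by [].
Qed.

(** The vanishing of the diagonal elements enters here: the pairing of
    p g^m with q g^n expands into four terms, of which g^m ⊗ g^n is 1 and
    p ⊗ g^n is inverse to g^n ⊗ p. *)
Lemma step_swap x y :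
  x * y = step_inj (step_proj x ⊗ step_proj y) * (y * x).
Proof.
rewrite !step_mulE /= ce_act1 add0r addrC; congr (_, _).
rewrite /ce_act /step_proj.
set a := zpow g x.2; set b := zpow g y.2; set p := pi x.1; set q := pi y.1.
rewrite mulgA ce_conj -/p -mulgA (ce_swap x.1) -/p -/q.
rewrite (mulgA y.1) ce_conj -/q !mulgA -!ce_injM -!mulgA.
congr (iota _ * _); rewrite tens_Ml !tens_Mr (wedge_zpow diagW).
rewrite (hom1 (actM q)) mulg1 -!mulgA -actM.
rewrite (_ : p ⊗ b * b ⊗ p = 1) ?wedge_alt // (hom1 (actM q)) mulg1.
by [].
Qed.

Definition comm_ext_step : comm_ext W :=
  CommExt step_projM step_injM step_inj_inj step_proj_inj step_conj step_swap.

End CommExtStep.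

Lemma comm_ext_over (G : groupType) (W : pairing G) (xs : seq G) :
  (forall g, tens W g g = 1) ->
  exists K : comm_ext W, forall g, g \in xs -> exists k : K, ce_proj k = g.
Proof.
move=> diagW; elim: xs => [|x xs [K IHK]]; first by exists (comm_ext_self W).
exists (comm_ext_step diagW K x) => g; rewrite inE => /orP[/eqP-> | /IHK[k <-]].
- exists ((1, 1%R) : step_group K x); rewrite /= /step_proj /=.
  by rewrite (hom1 (@ce_projM _ _ K)) mul1g.
- by exists ((k, 0%R) : step_group K x); rewrite /= /step_proj /= mulg1.
Qed.

(** * Abelian groups: central kernels and abelian quotients *)

Section CentralKernel.
Variables (L G : groupType) (p : central_hom L G).

Record cker := Cker {cker_val :> L; _ : p cker_val == 1}.
HB.instance Definition _ := [isSub for cker_val].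
HB.instance Definition _ := [Choice of cker by <:].

Lemma ckerP (x : cker) : p x = 1.
Proof. by case: x => x /= /eqP. Qed.

Fact cker_one_proof : p 1 == 1.
Proof. by rewrite (hom1 (@cfunM _ _ p)). Qed.
Fact cker_mul_proof (x y : cker) : p (val x * val y) == 1.
Proof. by rewrite cfunM !ckerP mulg1. Qed.
Fact cker_inv_proof (x : cker) : p (val x)^-1 == 1.
Proof. by rewrite (homV (@cfunM _ _ p)) ckerP invg1. Qed.

Definition cker_add x y := Cker (cker_mul_proof x y).
Definition cker_opp x := Cker (cker_inv_proof x).

Lemma cker_addA : associative cker_add.
Proof. by move=> x y z; apply: val_inj; rewrite /= mulgA. Qed.
Lemma cker_addC : commutative cker_add.
Proof. by move=> x y; apply: val_inj; apply: cfunC; apply: ckerP. Qed.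
Lemma cker_add0 : left_id (Cker cker_one_proof) cker_add.
Proof. by move=> x; apply: val_inj; rewrite /= mul1g. Qed.
Lemma cker_addN : left_inverse (Cker cker_one_proof) cker_opp cker_add.
Proof. by move=> x; apply: val_inj; rewrite /= mulVg. Qed.

HB.instance Definition _ :=
  GRing.isZmodule.Build cker cker_addA cker_addC cker_add0 cker_addN.

Lemma cker_valD (x y : cker) : cker_val (x + y)%R = cker_val x * cker_val y.
Proof. by []. Qed.
Lemma cker_valN (x : cker) : cker_val (- x)%R = (cker_val x)^-1.
Proof. by []. Qed.
Lemma cker_valMn (x : cker) n : cker_val (x *+ n)%R = cker_val x ^+ n.
Proof.
by elim: n => [//|n IHn]; rewrite mulrS cker_valD IHn expgS.
Qed.

End CentralKernel.

Record ab_subgroup (G : groupType) := AbSubgroup {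
  asub :> G -> Prop;
  asub1 : asub 1;
  asubV : forall g, asub g -> asub g^-1;
  asubM : forall g h, asub g -> asub h -> asub (g * h);
  asub_comm : forall g h, asub (lcomm g h) }.

Section AbQuotient.
Local Open Scope quotient_scope.
Variables (G : groupType) (N : ab_subgroup G).

Lemma asub_conj g h : N h -> N (lconj g h).
Proof.
by move=> Nh; have := asubM (asub_comm N g h) Nh; rewrite /lcomm mulgVK.
Qed.

Definition same_coset (g h : G) : bool := `[< N (g * h^-1) >].

Lemma same_coset_refl : reflexive same_coset.
Proof. by move=> g; apply/asboolP; rewrite mulgV; apply: asub1. Qed.
Lemma same_coset_sym : symmetric same_coset.
Proof.
by move=> g h; apply/asboolP/asboolP => /asubV; rewrite invgM invgK.
Qed.
Lemma same_coset_trans : transitive same_coset.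
Proof.
move=> h g k /asboolP gh /asboolP hk; apply/asboolP.
by have := asubM gh hk; rewrite !gnorm.
Qed.
Canonical same_coset_equiv :=
  EquivRel same_coset same_coset_refl same_coset_sym same_coset_trans.

Definition ab_quotient := {eq_quot same_coset}.
HB.instance Definition _ := Choice.on ab_quotient.

Definition ab_class (g : G) : ab_quotient := \pi_({eq_quot same_coset}) g.
Definition ab_repr (u : ab_quotient) : G := repr u.

Lemma ab_reprK : cancel ab_repr ab_class. Proof. exact: reprK. Qed.

Lemma ab_classP g h : ab_class g = ab_class h <-> N (g * h^-1).
Proof. by split=> [/eqmodP/asboolP | e] //; apply/eqmodP/asboolP. Qed.

Definition ab_add (u v : ab_quotient) := ab_class (ab_repr u * ab_repr v).
Definition ab_opp (u : ab_quotient) := ab_class (ab_repr u)^-1.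

Lemma ab_addE g h : ab_add (ab_class g) (ab_class h) = ab_class (g * h).
Proof.
apply/ab_classP.
have /ab_classP Ng := ab_reprK (ab_class g).
have /ab_classP Nh := ab_reprK (ab_class h).
set g' := ab_repr _ in Ng; set h' := ab_repr _ in Nh.
rewrite -/g' -/h'.
have -> : g' * h' * (g * h)^-1 = g' * g^-1 * lconj g (h' * h^-1).
  by rewrite /lconj !gnorm.
exact/asubM/asub_conj.
Qed.

Lemma ab_addA : associative ab_add.
Proof.
move=> u v w; rewrite -(ab_reprK u) -(ab_reprK v) -(ab_reprK w).
by rewrite !ab_addE mulgA.
Qed.
Lemma ab_addC : commutative ab_add.
Proof.
move=> u v; apply/ab_classP.
have -> : ab_repr u * ab_repr v * (ab_repr v * ab_repr u)^-1
        = lcomm (ab_repr u) (ab_repr v) by rewrite /lcomm /lconj !gnorm.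
exact: asub_comm.
Qed.
Lemma ab_add0 : left_id (ab_class 1) ab_add.
Proof. by move=> u; rewrite -(ab_reprK u) ab_addE mul1g. Qed.
Lemma ab_addN : left_inverse (ab_class 1) ab_opp ab_add.
Proof. by move=> u; rewrite -{2}(ab_reprK u) ab_addE mulVg. Qed.

HB.instance Definition _ :=
  GRing.isZmodule.Build ab_quotient ab_addA ab_addC ab_add0 ab_addN.

Lemma ab_classD g h : ab_class (g * h) = (ab_class g + ab_class h)%R.
Proof. by rewrite -ab_addE. Qed.

End AbQuotient.

Local Open Scope ring_scope.

(** * Additive maps out of free abelian groups and homology *)

Section FreegLift.
Variables (X : choiceType) (V : zmodType).

(** The library lift needs a module as target; any abelian group is a module
    over the integers through the alias zmodule. *)
Definition freeg_lift (f : X -> V) : {freeg X / int} -> V :=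
  fglift (f : X -> zmodule V).

HB.instance Definition _ f := GRing.isZmodMorphism.Build _ _ (freeg_lift f)
  (@lift_is_additive _ _ (zmodule V) f).

Lemma freeg_lift_gen f x : freeg_lift f << x >> = f x.
Proof. by rewrite /freeg_lift liftU scale1r. Qed.

Lemma freeg_ind (P : {freeg X / int} -> Prop) :
  P 0 -> (forall x, P << x >>) -> (forall u, P u -> P (- u)) ->
  (forall u v, P u -> P v -> P (u + v)) -> forall u, P u.
Proof.
move=> P0 Pg PN PD u; rewrite -[u]freeg_sumE.
elim/big_rec: _ => [//|x v _ Pv]; apply: (PD _ _ _ Pv).
rewrite -[coeff _ _]intz -freegU_mulz.
have Pn n : P (<< x >> *+ n) by elim: n => [//|n IHn]; rewrite mulrS; apply: PD.
by case: (coeff _ _) => n; rewrite ?NegzE ?mulrNz; [apply: Pn | apply/PN/Pn].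
Qed.

Lemma freeg_ext (f f' : {additive {freeg X / int} -> V}) :
  (forall x, f << x >> = f' << x >>) -> f =1 f'.
Proof.
move=> e; apply: freeg_ind => [|//|u eu|u v eu ev].
- by rewrite !raddf0.
- by rewrite !raddfN eu.
- by rewrite !raddfD eu ev.
Qed.

End FreegLift.

Section HomologyLift.
Variables (A B C V : zmodType) (d' : {additive A -> B}) (d : {additive B -> C}).
Variable f : {additive B -> V}.
Hypothesis fd' : forall a, f (d' a) = 0.

Definition hlift (u : homology d' d) : V := f (val (hrepr u)).

Lemma hlift_class z : hlift (hclass d' z) = f (val z).
Proof.
have /hclassP[a e] := hreprK (hclass d' z).
by apply/eqP; rewrite -subr_eq0 -raddfB e fd'.
Qed.

Lemma hclassD (z w : cycles d) : hclass d' (z + w) = hclass d' z + hclass d' w.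
Proof. by rewrite -[RHS]/(hadd _ _) haddE. Qed.

Lemma hliftD : {morph hlift : u v / u + v}.
Proof.
move=> u v; rewrite -(hreprK u) -(hreprK v) -hclassD !hlift_class.
by rewrite raddfD.
Qed.

End HomologyLift.

Lemma additive_of (U V : zmodType) (f : U -> V) :
  {morph f : x y / x + y} -> exists F : {additive U -> V}, F =1 f.
Proof.
move=> fD; have f0 : f 0 = 0 by apply: (@addrI _ (f 0)); rewrite -fD !addr0.
have fB : {morph f : x y / x - y}.
  by move=> x y; apply: (@addIr _ (f y)); rewrite -fD !subrK.
pose m := GRing.isZmodMorphism.Build U V f fB.
by exists (HB.pack f m : {additive U -> V}).
Qed.

(** * First homology *)

Section FirstHomology.
Variable G : groupType.

Lemma cycle1_proof (z : {freeg G / int}) : is_cycle (@bar_d1 G) z.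
Proof.
apply/eqP; apply: (freeg_ext (f := @bar_d1 G) (f' := \0%R)) => g /=.
by rewrite /bar_d1 fglift_gen subrr.
Qed.

Definition H1_of (z : {freeg G / int}) : H1 G := hclass _ (Cycle (cycle1_proof z)).

Lemma H1_ofD : {morph H1_of : z w / z + w}.
Proof. by move=> z w; rewrite -hclassD; congr hclass; apply: val_inj. Qed.

Definition H1_class (g : G) : H1 G := H1_of << g >>.

Lemma H1_classM g h : H1_class (g * h)%g = H1_class g + H1_class h.
Proof.
rewrite /H1_class -H1_ofD; apply/hclassP; exists (- << (g, h) >>) => /=.
rewrite raddfN /= bar_d2E !opprD opprK [RHS]addrAC [RHS]addrC.
by rewrite [- << h >> - _]addrC.
Qed.

Lemma H1_class1 : H1_class 1%g = 0.
Proof. by apply: (@addrI _ (H1_class 1%g)); rewrite -H1_classM mulg1 addr0. Qed.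

Lemma H1_classV g : H1_class g^-1%g = - H1_class g.
Proof.
by apply: (@addrI _ (H1_class g)); rewrite -H1_classM mulgV subrr H1_class1.
Qed.

Lemma H1_class_surj (u : H1 G) : exists g, H1_class g = u.
Proof.
rewrite -(hreprK u); case: (hrepr u) => z zP.
have -> : Cycle zP = Cycle (cycle1_proof z) by apply: val_inj.
rewrite -/(H1_of z); move: z {zP}.
apply: freeg_ind => [|g|z [g eg]|z w [g eg] [h eh]].
- exists 1%g; rewrite H1_class1; apply: (@addrI _ (H1_of 0)).
  by rewrite -H1_ofD !addr0.
- by exists g.
- exists g^-1%g; rewrite H1_classV eg; apply: (@addrI _ (H1_of z)).
  apply: (@addrI _ (H1_of 0)).
  by rewrite subrr -H1_ofD -H1_ofD addr0 subrr addr0.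
- by exists (g * h)%g; rewrite H1_classM eg eh H1_ofD.
Qed.

Section HomFactor.
Variables (V : zmodType) (u : G -> V).
Hypothesis uM : forall g h, u (g * h)%g = u g + u h.

Let u_d2 x : freeg_lift u (bar_d2 x) = 0.
Proof.
apply: (freeg_ext (f := freeg_lift u \o @bar_d2 G) (f' := \0%R)) => -[g h] /=.
rewrite bar_d2E raddfD raddfB /= !freeg_lift_gen uM opprD addrA addrAC.
by rewrite subrK subrr.
Qed.

Lemma hom_H1 : exists F : {additive H1 G -> V}, forall g, F (H1_class g) = u g.
Proof.
have [F eF] := additive_of (hliftD (d := @bar_d1 G) u_d2).
by exists F => g; rewrite eF hlift_class //= freeg_lift_gen.
Qed.

End HomFactor.

(** The expansion clause is the universal property of the abelianization Z^n
    in coordinates: every homomorphism from G to an abelian group factors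
    through H1 G, where the xs k form a basis. *)
Lemma H1_basis : fg_free_abelian (H1 G) ->
  exists n (ell : G -> 'rV[int]_n) (xs : 'I_n -> G),
    [/\ forall g h, ell (g * h)%g = ell g + ell h,
        forall k, ell (xs k) = delta_mx ord0 k &
    (forall (V : zmodType) (u : G -> V),
       (forall g h, u (g * h)%g = u g + u h) ->
       forall g, u g = \sum_k u (xs k) *~ ell g ord0 k)].
Proof.
case=> n [f [finv fK finvK]].
have [xs xsE] := fin_all_exists (fun k => H1_class_surj (f (delta_mx ord0 k))).
exists n, (finv \o H1_class), xs; split=> [g h|k|V u uM g] /=.
- by rewrite H1_classM; apply: (can_inj fK); rewrite raddfD /= !finvK.
- by rewrite xsE fK.
have [F FE] := hom_H1 uM.
rewrite -FE -{1}(finvK (H1_class g)); set v := finv _.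
rewrite [in LHS](row_sum_delta v) !raddf_sum /=.
apply: eq_bigr => k _; rewrite -FE xsE -raddfMz /= -raddfMz /=.
by rewrite -scaler_int intz.
Qed.

(** The expansion applied to the projection of G onto its quotient by N. *)
Lemma ab_subgroup_full (N : ab_subgroup G) n (ell : G -> 'rV[int]_n) xs :
  (forall (V : zmodType) (u : G -> V),
     (forall g h, u (g * h)%g = u g + u h) ->
     forall g, u g = \sum_k u (xs k) *~ ell g ord0 k) ->
  (forall k, N (xs k)) -> forall g, N g.
Proof.
move=> expand Nxs g.
have cl0 h : N h -> ab_class N h = 0.
  by move=> Nh; apply/ab_classP; rewrite invg1 mulg1.
suff /ab_classP : ab_class N g = ab_class N 1%g by rewrite invg1 mulg1.
rewrite (expand _ _ (ab_classD N)) big1 => [//|k _].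
by rewrite cl0 ?mul0rz.
Qed.

End FirstHomology.

(** * Cocycles and twisted products *)

(** No normalization is imposed, since the universal cocycle is not normalized:
    the identity of the extension is then (- c 1 1, 1). *)
Record cocycle (G : groupType) (A : zmodType) := Cocycle {
  coc :> G -> G -> A;
  cocP : forall g h k,
    coc g h + coc (g * h)%g k = coc h k + coc g (h * k)%g }.

(** The type does not depend on c; the parameter is there for the group law,
    which does, to be found from the type. *)
Definition twisted (G : groupType) (A : zmodType) (c : cocycle G A) : Type :=
  (A * G)%type.
HB.instance Definition _ G A (c : cocycle G A) :=
  Choice.copy (twisted c) (A * G)%type.

Section Twisted.
Variables (G : groupType) (A : zmodType) (c : cocycle G A).

Lemma coc1g g : c 1%g g = c 1%g 1%g.
Proof. by have := cocP c 1%g 1%g g; rewrite !mul1g => /addIr. Qed.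

Lemma cocg1 g : c g 1%g = c 1%g 1%g.
Proof. by have := cocP c g 1%g 1%g; rewrite !mulg1 => /addIr. Qed.

Lemma cocgV g : c g g^-1%g = c g^-1%g g.
Proof.
have := cocP c g g^-1%g g; rewrite mulgV mulVg coc1g cocg1; exact: addIr.
Qed.

Definition tw_mul (x y : twisted c) : twisted c :=
  (x.1 + (y.1 + c x.2 y.2), (x.2 * y.2)%g).
Definition tw_one : twisted c := (- c 1%g 1%g, 1%g).
Definition tw_inv (x : twisted c) : twisted c :=
  (- c 1%g 1%g - (x.1 + c x.2^-1%g x.2), x.2^-1%g).

Lemma tw_mulA : associative tw_mul.
Proof.
move=> [m g] [n h] [r k]; rewrite /tw_mul /= mulgA; congr (_, _).
rewrite -!addrA; do 2 congr (_ + _).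
by rewrite [RHS]addrCA cocP.
Qed.
Lemma tw_mul1 : left_id tw_one tw_mul.
Proof. by case=> m g; rewrite /tw_mul /= mul1g coc1g addrCA addNr addr0. Qed.
Lemma tw_mulr1 : right_id tw_one tw_mul.
Proof. by case=> m g; rewrite /tw_mul /= mulg1 cocg1 addNr addr0. Qed.
Lemma tw_mulVr : left_inverse tw_one tw_inv tw_mul.
Proof. by case=> m g; rewrite /tw_mul /= mulVg subrK. Qed.
Lemma tw_mulrV : right_inverse tw_one tw_inv tw_mul.
Proof.
case=> m g; rewrite /tw_mul /= mulgV cocgV; congr (_, _).
by rewrite opprD [- c _ _ + _]addrA subrK addrCA subrr addr0.
Qed.

HB.instance Definition _ := isGroup.Build (twisted c)
  tw_mulA tw_mul1 tw_mulr1 tw_mulVr tw_mulrV.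

Lemma tw_mulE (x y : twisted c) :
  (x * y)%g = (x.1 + (y.1 + c x.2 y.2), (x.2 * y.2)%g).
Proof. by []. Qed.

Lemma tw_oneE : (1%g : twisted c) = (- c 1%g 1%g, 1%g).
Proof. by []. Qed.

Lemma tw_sndM : {morph (fun x : twisted c => x.2) : x y / (x * y)%g}.
Proof. by []. Qed.

Lemma tw_sndC (z x : twisted c) : z.2 = 1%g -> (z * x = x * z)%g.
Proof.
case: z x => [m g] [n h] /= ->; rewrite !tw_mulE /= mulg1 mul1g coc1g cocg1.
by rewrite addrCA.
Qed.

Definition tw_proj : central_hom (twisted c) G := CentralHom tw_sndM tw_sndC.

Definition tw_sec (g : G) : twisted c := (0, g).
Lemma tw_secK : cancel tw_sec tw_proj. Proof. by []. Qed.

(** On the fiber over 1 the shift m |-> m + c 1 1 is an isomorphism to A. *)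
Lemma tw_fiberX m n :
  (((m, 1%g) : twisted c) ^+ n)%g
    = ((m + c 1%g 1%g) *+ n - c 1%g 1%g, 1%g).
Proof.
elim: n => [|n IHn]; first by rewrite expg0 mulr0n add0r.
by rewrite expgS IHn tw_mulE /= mulg1 subrK mulrS
  [m + c _ _ + _]addrAC addrK.
Qed.

Lemma bar_coc_d3 x : freeg_lift (fun p => c p.1 p.2) (bar_d3 x) = 0.
Proof.
apply: (freeg_ext (f := freeg_lift (fun p => c p.1 p.2) \o @bar_d3 G)
  (f' := \0)) => -[[g h] k] /=.
rewrite bar_d3E !(raddfB, raddfD) /= !freeg_lift_gen /=.
by rewrite [X in X - _]addrAC -cocP addrK subrr.
Qed.

End Twisted.

Section SectionCocycle.
Variables (L G : groupType) (p : central_hom L G) (s : G -> L).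
Hypothesis sK : cancel s p.
Local Open Scope group_scope.

Fact sec_coc_proof g h : p (s g * s h * (s (g * h))^-1) == 1.
Proof. by rewrite !(cfunM, homV (@cfunM _ _ p)) !sK mulgV. Qed.

Definition sec_coc g h : cker p := Cker (sec_coc_proof g h).

Lemma sec_cocP g h k :
  (sec_coc g h + sec_coc (g * h) k = sec_coc h k + sec_coc g (h * k))%R.
Proof.
apply: val_inj; rewrite /=.
have zC x := cfunC x (eqP (sec_coc_proof h k)).
move: zC; set z := s h * s k * _ => zC.
have -> : z * (s g * s (h * k) * (s (g * (h * k)))^-1)
        = s g * z * (s (h * k) * (s (g * (h * k)))^-1).
  by rewrite -zC !mulgA.
by rewrite /z !gnorm.
Qed.

Definition sec_cocycle : cocycle G (cker p) := Cocycle sec_cocP.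

End SectionCocycle.

(** * The universal cocycle of the bar complex *)

Section UniversalCocycle.
Variable G : groupType.

(** The cokernel of bar_d3, presented as homology at the middle term of a
    sequence whose second map is zero. *)
Definition bar2_coker : zmodType :=
  homology (@bar_d3 G) (\0%R : {additive {freeg G * G} -> {freeg G * G}}).

Fact bar2_cycle_proof (b : {freeg G * G}) :
  is_cycle (\0%R : {additive {freeg G * G} -> {freeg G * G}}) b.
Proof. exact/eqP. Qed.

Definition bar2_class (b : {freeg G * G}) : bar2_coker :=
  hclass _ (Cycle (bar2_cycle_proof b)).

Lemma bar2_classD : {morph bar2_class : a b / a + b}.
Proof. by move=> a b; rewrite -hclassD; congr hclass; apply: val_inj. Qed.

Lemma bar2_classP a b :
  bar2_class a = bar2_class b <-> exists w, a - b = bar_d3 w.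
Proof. exact: hclassP. Qed.

Lemma bar2_class_surj (u : bar2_coker) : exists b, u = bar2_class b.
Proof.
exists (val (hrepr u)); rewrite -{1}(hreprK u); congr hclass.
exact: val_inj.
Qed.

Lemma bar2_lift (V : zmodType) (f : {additive {freeg G * G} -> V}) :
  (forall w, f (bar_d3 w) = 0) ->
  exists F : {additive bar2_coker -> V}, forall b, F (bar2_class b) = f b.
Proof.
move=> fd.
have [F eF] := additive_of (hliftD (d := \0%R : {additive _ -> {freeg G * G}}) fd).
by exists F => b; rewrite eF hlift_class.
Qed.

Lemma univ_cocP g h k :
  bar2_class << (g, h) >> + bar2_class << ((g * h)%g, k) >> =
  bar2_class << (h, k) >> + bar2_class << (g, (h * k)%g) >>.
Proof.
rewrite -!bar2_classD; apply/bar2_classP; exists (- << (g, h, k) >>).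
rewrite raddfN /= bar_d3E !opprD !opprK.
by rewrite [RHS]addrC -!addrA; congr (_ + _); rewrite addrCA.
Qed.

Definition univ_cocycle : cocycle G bar2_coker := Cocycle univ_cocP.

Definition univ_ext := twisted univ_cocycle.

(** The section s defines a cocycle with values in ker p, that is, an additive
    map F on bar2_coker; the homomorphism is (m, g) |-> F m * s g. *)
Lemma univ_ext_lift (L : groupType) (p : central_hom L G) (s : G -> L) :
  cancel s p -> exists f : univ_ext -> L,
    {morph f : x y / (x * y)%g} /\ forall g, f (tw_sec univ_cocycle g) = s g.
Proof.
move=> sK.
have [F FE] := bar2_lift (bar_coc_d3 (sec_cocycle sK)).
have F1 g h : F (bar2_class << (g, h) >>) = sec_coc sK g h.
  by rewrite FE /= freeg_lift_gen.
exists (fun x => (cker_val (F x.1) * s x.2)%g); split=> [[m g] [n h]|g] /=.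
  rewrite !raddfD /= F1 /= -!mulgA mulVg mulg1; congr (_ * _)%g.
  by rewrite mulgA [in RHS]mulgA; congr (_ * _)%g; apply: cfunC; apply: ckerP.
by rewrite raddf0 mul1g.
Qed.

End UniversalCocycle.

(** * Torsion of the tensor square dies in the universal extension *)

Section TensorHomology.
Variable G : groupType.
Local Notation T := (tensor_pairing G).
Local Notation c := (univ_cocycle G).

Definition tensor_univ : T -> univ_ext G := comm_lift (tw_sec c).

Lemma tensor_univM : {morph tensor_univ : x y / (x * y)%g}.
Proof. exact: comm_liftM (@tw_secK _ _ c). Qed.

Lemma tensor_univ_tens g h :
  tensor_univ (tens _ g h) = lcomm (tw_sec c g) (tw_sec c h).
Proof. exact: comm_lift_tens (@tw_secK _ _ c) _ _. Qed.

Lemma tensor_univ_snd t : (tensor_univ t).2 = bd t.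
Proof. exact: (bd_comm_lift (@tw_secK _ _ c)). Qed.

(** The map (m, g) |-> d2 m + [g] is a homomorphism from the universal extension
    to an abelian group, and the image of the tensor square consists of
    products of commutators. *)
Lemma tensor_univ_cycle (D : {additive bar2_coker G -> {freeg G / int}}) t :
  (forall b, D (bar2_class b) = bar_d2 b) ->
  D (tensor_univ t).1 + << (tensor_univ t).2 >> = 0.
Proof.
move=> DE; pose theta (x : univ_ext G) := D x.1 + << x.2 >>.
have thetaM x y : theta (x * y)%g = theta x + theta y.
  rewrite /theta tw_mulE /= !raddfD /= DE bar_d2E -!addrA; congr (_ + _).
  rewrite [RHS]addrCA; congr (_ + _).
  by rewrite [X in _ + X]addrCA addNr addr0 addrC.
have theta1 : theta 1%g = 0.
  by apply: (@addrI _ (theta 1%g)); rewrite -thetaM mulg1 addr0.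
have thetaV x : theta x^-1%g = - theta x.
  by apply: (@addrI _ (theta x)); rewrite -thetaM mulgV theta1 subrr.
rewrite -/(theta _); elim/tens_ind: t => [|g h|x IHx|x y IHx IHy].
- by rewrite (hom1 tensor_univM).
- rewrite tensor_univ_tens /lcomm /lconj !(thetaM, thetaV).
  by rewrite addrAC addrK subrr.
- by rewrite (homV tensor_univM) thetaV IHx oppr0.
- by rewrite tensor_univM thetaM IHx IHy addr0.
Qed.

Lemma hclassMn (A B C : zmodType) (d' : {additive A -> B})
  (d : {additive B -> C}) (z : cycles d) n :
  hclass d' z *+ n = hclass d' (z *+ n).
Proof. by elim: n => [//|n IHn]; rewrite !mulrS hclassD IHn. Qed.

(** For t with trivial boundary, the first coordinate of the image, shifted
    by the class of [1|1], is represented by a 2-cycle, hence is a class of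
    H2 G, and it is additive in t. *)
Lemma tensor_univ_torsion t n : torsion_free (H2 G) ->
  bd t = 1%g -> (0 < n)%N -> (t ^+ n = 1)%g -> tensor_univ t = 1%g.
Proof.
move=> H2tf dt n0 tn.
have [D DE] := bar2_lift (@bar_d2d3 G).
have := tensor_univ_cycle t DE.
have := homX tensor_univM n t; rewrite tn (hom1 tensor_univM).
have := tensor_univ_snd t; rewrite dt; case: (tensor_univ t) => m g /= ->.
rewrite tw_fiberX => -[] e Dm.
have m0 : (m + c 1%g 1%g) *+ n = 0.
  by apply: (@addIr _ (- c 1%g 1%g)); rewrite add0r.
suff mc : m + c 1%g 1%g = 0.
  by rewrite tw_oneE; congr (_, _); apply/eqP; rewrite -addr_eq0 mc.
have : D (m + c 1%g 1%g) = 0.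
  by rewrite raddfD /= DE /= bar_d2E mulg1 subrr add0r.
have [z ez] := bar2_class_surj (m + c 1%g 1%g); rewrite ez DE => /eqP dz.
have valMn (C : zmodType) (d : {additive {freeg G * G} -> C}) (y : cycles d) k :
  val (y *+ k) = val y *+ k by exact: raddfMn.
have class0 (C : zmodType) (d : {additive {freeg G * G} -> C}) (y : cycles d) :
  hclass (@bar_d3 G) y = 0 <-> exists w, val y = bar_d3 w.
  by rewrite -(subr0 (val y)); apply: (@hclassP _ _ _ (@bar_d3 G) d y 0).
have : hclass (@bar_d3 G) (Cycle dz) = 0.
  apply: (H2tf _ n n0); rewrite hclassMn; apply/class0; rewrite valMn /=.
  move: m0; rewrite ez /bar2_class hclassMn => /class0.
  by rewrite valMn.
by move=> /class0 zP; apply/class0.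
Qed.

(** Both comm_lift s and the composite of tensor_univ with the map given by
    univ_ext_lift send g ⊗ h to [s g, s h]. *)
Lemma tensor_univ_lift (L : groupType) (p : central_hom L G) (s : G -> L) t :
  cancel s p -> tensor_univ t = 1%g -> comm_lift s t = 1%g.
Proof.
move=> sK ut; have [f [fM fs]] := univ_ext_lift sK.
suff -> : comm_lift s t = f (tensor_univ t) by rewrite ut (hom1 fM).
apply: (eq_hom_tens (f := comm_lift s) (f' := f \o tensor_univ)).
- exact: comm_liftM sK.
- by move=> x y; rewrite /comp tensor_univM fM.
- move=> g h; rewrite /comp tensor_univ_tens (hom_lcomm fM) !fs.
  exact: comm_lift_tens sK _ _.
Qed.

End TensorHomology.

(** * The exterior square embeds in the universal extension *)

Section WedgeEmbedding.
Variable G : groupType.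
Local Open Scope group_scope.
Local Notation W := (wedge_pairing G).

Lemma ce_projC (K : comm_ext W) (z x : K) : ce_proj z = 1 -> z * x = x * z.
Proof.
by move=> pz; rewrite ce_swap pz tens1g (hom1 (@ce_injM _ _ K)) mul1g.
Qed.

Definition ce_central (K : comm_ext W) : central_hom K G :=
  CentralHom (@ce_projM _ _ K) (@ce_projC K).

Definition ce_image (K : comm_ext W) : ab_subgroup G.
Proof.
exists (fun g => exists k : K, ce_proj k = g).
- by exists 1; rewrite (hom1 (@ce_projM _ _ K)).
- by move=> g [k <-]; exists k^-1; rewrite (homV (@ce_projM _ _ K)).
- by move=> g h [k <-] [l <-]; exists (k * l); rewrite ce_projM.
- move=> g h; exists (ce_inj K (tens _ g h)).
  by rewrite ce_proj_inj bd_tens.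
Defined.

Lemma comm_lift_wedge (K : comm_ext W) (s : G -> K) (t : tensor_pairing G) :
  cancel s (@ce_proj _ _ K) -> comm_lift s t = ce_inj K (wedge_of t).
Proof.
move=> sK; have sK' : cancel s (ce_central K) := sK.
apply: (eq_hom_tens (f := comm_lift s) (f' := @ce_inj _ _ K \o @wedge_of G)).
- exact: comm_liftM sK'.
- by move=> x y; rewrite /comp wedge_ofM ce_injM.
- move=> g h; rewrite /comp wedge_of_tens (comm_lift_tens sK') /lcomm /lconj.
  by rewrite (ce_swap (s g) (s h)) !sK !gnorm.
Qed.

(** The image of a comm_ext contains all commutators, so it is G once it contains
    representatives of a basis of H1 G. *)
Lemma wedge_of_univ_ker (t : tensor_pairing G) :
  fg_free_abelian (H1 G) -> tensor_univ t = 1 -> wedge_of t = 1.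
Proof.
move=> /H1_basis[n [ell [xs [_ _ expand]]]] ut.
have [K Kxs] := comm_ext_over [seq xs k | k <- enum 'I_n] (@tens_wedge_diag G).
have surj g : exists k : K, ce_proj k = g.
  apply: (@ab_subgroup_full _ (ce_image K) n ell xs) => // k.
  by apply: Kxs; apply: map_f; rewrite mem_enum.
have [s sK] := choice surj.
have := comm_lift_wedge t sK.
rewrite (@tensor_univ_lift _ _ (ce_central K)) // => e.
by apply: (@ce_inj_inj _ _ K); rewrite -e (hom1 (@ce_injM _ _ K)).
Qed.

End WedgeEmbedding.

(** * The subgroup of diagonal tensors *)

Section Diagonal.
Variables (G : groupType) (W : pairing G).
Local Open Scope group_scope.
Local Notation "g ⊗ h" := (@tens G W g h) (at level 30).

Definition bd_central : central_hom W G :=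
  CentralHom (@bdM _ W) (fun z x => bd1_central x (x := z)).

Lemma bd_diag g : bd (g ⊗ g) = 1.
Proof. by rewrite bd_tens /lcomm /lconj !gnorm. Qed.
Lemma bd_symm g h : bd ((g ⊗ h) * (h ⊗ g)) = 1.
Proof. by rewrite bdM !bd_tens /lcomm /lconj !gnorm. Qed.

Definition diag g : cker bd_central := @Cker _ _ bd_central _ (introT eqP (bd_diag g)).
(** The polar form of the quadratic map diag. *)
Definition symm g h : cker bd_central := @Cker _ _ bd_central _ (introT eqP (bd_symm g h)).

Lemma symmC g h : symm g h = symm h g.
Proof.
apply: val_inj => /=; apply: (@mulgI _ (h ⊗ g)).
by rewrite mulgA; apply/bd1_central/bd_symm.
Qed.

Lemma symmMl g h k : symm (g * h) k = (symm g k + symm h k)%R.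
Proof.
rewrite addrC; apply: val_inj => /=; rewrite tens_Ml tens_Mr -!mulgA.
rewrite (mulgA (g ⊗ k)) (bd1_central _ (bd_symm g k)).
rewrite !mulgA -actM (bd1_act g (bd_symm h k)) -!mulgA; congr (_ * (_ * _)).
Qed.

Lemma symm_diag g : symm g g = (diag g + diag g)%R.
Proof. exact: val_inj. Qed.

Lemma diagM g h : diag (g * h) = (diag g + diag h + symm g h)%R.
Proof.
rewrite symmC addrAC [RHS]addrC [(diag g + _)%R]addrC.
apply: val_inj => /=; rewrite tens_Ml !tens_Mr actM.
rewrite !(bd1_act _ (bd_diag h)) -(bd1_central _ (bd_diag h)) -mulgA.
congr (_ * _); rewrite (bd1_central _ (bd_diag g)) mulgA -actM.
by rewrite (bd1_act g (bd_symm h g)).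
Qed.

End Diagonal.

(** An abelian group written multiplicatively, as a target for the universal
    property of a presented group. *)
Definition additive_group (V : zmodType) : Type := V.
HB.instance Definition _ (V : zmodType) := Choice.copy (additive_group V) V.
HB.instance Definition _ (V : zmodType) := isGroup.Build (additive_group V)
  (@addrA V) (@add0r V) (@addr0 V) (@addNr V) (@addrN V).

Lemma additive_groupM (V : zmodType) (x y : additive_group V) :
  (x * y)%g = (x : V) + (y : V).
Proof. by []. Qed.

Section DiagonalTorsion.
Variables (G : groupType) (n : nat) (ell : G -> 'rV[int]_n) (xs : 'I_n -> G).
Local Notation T := (tensor_pairing G).
Local Notation J := (cker (bd_central T)).
Hypothesis ellM : forall g h, ell (g * h)%g = ell g + ell h.
Hypothesis ell_xs : forall k, ell (xs k) = delta_mx ord0 k.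
Hypothesis expand : forall (V : zmodType) (u : G -> V),
  (forall g h, u (g * h)%g = u g + u h) ->
  forall g, u g = \sum_k u (xs k) *~ ell g ord0 k.

(** A bilinear form on Z^n need not be symmetric to have the prescribed
    diagonal values; an upper triangular one avoids halving the polar form. *)
Definition diag_coef i j : J :=
  if i == j then diag T (xs i) else
  if (i < j)%N then symm T (xs i) (xs j) else 0.

Definition diag_form (S : 'M[int]_n) : J :=
  \sum_i \sum_j diag_coef i j *~ S i j.

Lemma diag_formD : {morph diag_form : S U / S + U}.
Proof.
move=> S U; rewrite /diag_form -big_split; apply: eq_bigr => i _ /=.
by rewrite -big_split; apply: eq_bigr => j _ /=; rewrite mxE mulrzDr.
Qed.

Lemma diag_coefC i j : diag_coef i j + diag_coef j i = symm T (xs i) (xs j).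
Proof.
rewrite /diag_coef eq_sym; case: eqVneq => [->|]; first by rewrite symm_diag.
rewrite neq_ltn; case: ltngtP => // _ _; rewrite ?addr0 ?add0r //.
exact: symmC.
Qed.

Lemma symm_expand g h : symm T g h =
  \sum_i \sum_j symm T (xs i) (xs j) *~ (ell g ord0 i * ell h ord0 j).
Proof.
rewrite (expand (u := symm T ^~ h)); last by move=> g1 g2; apply: symmMl.
apply: eq_bigr => i _.
have symmMr g1 g2 : symm T (xs i) (g1 * g2)%g
    = symm T (xs i) g1 + symm T (xs i) g2.
  by rewrite symmC symmMl ![symm T _ (xs i)]symmC.
rewrite (expand symmMr h) mulrz_suml; apply: eq_bigr => j _.
by rewrite mulrC mulrzA.
Qed.

(** The two sides are quadratic in g with the same polar form, so their
    difference is a homomorphism; it vanishes on the xs k. *)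
Lemma diag_form_ell g : diag T g = diag_form ((ell g)^T *m ell g).
Proof.
pose defect h := diag T h - diag_form ((ell h)^T *m ell h).
have outer h1 h2 i j : ((ell h1)^T *m ell h2) i j = ell h1 ord0 i * ell h2 ord0 j.
  by rewrite mxE big_ord1 mxE.
have cross h1 h2 : symm T h1 h2
    = diag_form ((ell h1)^T *m ell h2) + diag_form ((ell h2)^T *m ell h1).
  rewrite symm_expand /diag_form [X in _ + X]exchange_big -big_split /=.
  apply: eq_bigr => i _; rewrite -big_split; apply: eq_bigr => j _ /=.
  by rewrite !outer [ell h2 _ _ * _]mulrC -mulrzDl diag_coefC.
have defectM h1 h2 : defect (h1 * h2)%g = defect h1 + defect h2.
  rewrite /defect ellM diagM cross [(_ + _)^T]linearD /= mulmxDl !mulmxDr !diag_formD.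
  set a := diag_form _; set b := diag_form _; set c := diag_form _.
  set e := diag_form _; apply/eqP; rewrite subr_eq; apply/eqP.
  rewrite [diag T h1 - c + _]addrACA -[RHS]addrA; congr (_ + _).
  by rewrite -[c + a + _]addrA [RHS]addrACA addNr add0r [RHS]addrC !addrA addrK.
have ellxs k i : ell (xs k) ord0 i = (i == k)%:R by rewrite ell_xs mxE.
have defect_xs k : defect (xs k) = 0.
  rewrite /defect /diag_form (bigD1 k) //= (bigD1 k) //= !big1 => [|i ik|j jk].
  - by rewrite !addr0 outer !ellxs !eqxx mulr1 mulr1z /diag_coef eqxx subrr.
  - by apply: big1 => j _; rewrite outer !ellxs (negPf ik) mul0r mulr0z.
  - by rewrite outer !ellxs (negPf jk) mulr0 mulr0z.
suff : defect g = 0 by move/eqP; rewrite subr_eq0 => /eqP.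
by rewrite (expand defectM) big1 // => k _; rewrite defect_xs mul0rz.
Qed.

Definition tensor_mx : T -> additive_group 'M[int]_n :=
  pres_lift (fun p : G * G => (ell p.1)^T *m ell p.2 : additive_group _).

Let ellJ g h : ell (lconj g h) = ell h.
Proof.
by apply: (@addIr _ (ell g)); rewrite -ellM /lconj mulgVK ellM addrC.
Qed.

Let tensor_mxR u v : @tensor_rel G u v ->
  word_eval (fun p : G * G => (ell p.1)^T *m ell p.2 : additive_group _) u =
  word_eval (fun p : G * G => (ell p.1)^T *m ell p.2 : additive_group _) v.
Proof.
apply: tensor_eval => g h k; rewrite /= !ellJ ellM additive_groupM.
- by rewrite addrC [(_ + _)^T]linearD /= mulmxDl.
- by rewrite mulmxDr.
Qed.

(** An element killed in the exterior square is a product of diagonal tensors,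
    hence equal to diag_form of its matrix; and integer matrices have no
    torsion. *)
Lemma diag_span_torsion (t : T) m :
  wedge_of t = 1%g -> (0 < m)%N -> (t ^+ m = 1)%g -> t = 1%g.
Proof.
move=> wt m0 tm; 
have mxM : {morph tensor_mx : x y / (x * y)%g} := pres_liftM tensor_mxR.
have [F FE] := additive_of diag_formD.
have diag_span : t = cker_val (F (tensor_mx t)).
  apply: (@wedge_ker _ (fun t => t = cker_val (F (tensor_mx t)))) wt.
  - by rewrite (hom1 mxM) [F _](raddf0 F).
  - by move=> x ex; rewrite (homV mxM) [F _](raddfN F) cker_valN -ex.
  - by move=> x y ex ey; rewrite mxM [F _](raddfD F) cker_valD -ex -ey.
  - by move=> x y ->; apply: bd1_central; apply: (ckerP (F (tensor_mx x))).
  - move=> g; rewrite FE [tensor_mx _](pres_lift_gen tensor_mxR) /=.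
    by rewrite -diag_form_ell.
have mx0 : (tensor_mx t : 'M[int]_n) *+ m = 0.
  have := homX mxM m t; rewrite tm (hom1 mxM) => e.
  rewrite [RHS]e; elim: (m) => [//|k IHk]; by rewrite expgS mulrS IHk.
rewrite diag_span; suff -> : (tensor_mx t : 'M[int]_n) = 0 by rewrite raddf0.
apply/matrixP => i j; move/matrixP/(_ i j): mx0; rewrite mulmxnE !mxE.
by move=> /eqP; rewrite Num.Theory.mulrn_eq0 -leqn0 leqNgt m0 => /eqP.
Qed.

End DiagonalTorsion.

(** * The kernel of the commutator map is torsion-free *)

Section TensorKernel.
Variable G : groupType.
Hypotheses (H1free : fg_free_abelian (H1 G)) (H2tf : torsion_free (H2 G)).

Lemma tensor_kernel_torsion_free : torsion_free (cker (bd_central (tensor_pairing G))).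
Proof.
move=> x m m0 xm; apply: val_inj => /=.
have dx := ckerP x; have xm1 : (cker_val x ^+ m = 1)%g by rewrite -cker_valMn xm.
have [n [ell [xs [ellM ell_xs expand]]]] := H1_basis H1free.
apply: (diag_span_torsion ellM ell_xs expand _ m0 xm1).
apply: wedge_of_univ_ker H1free _.
exact: tensor_univ_torsion H2tf dx m0 xm1.
Qed.

End TensorKernel.

(** * Torsion-free abelian groups are orderable *)

Section OrderTorsionFree.
Variable V : zmodType.

Record add_cone := AddCone {
  cone :> V -> Prop;
  cone0 : ~ cone 0;
  coneD : forall x y, cone x -> cone y -> cone (x + y) }.

Lemma coneMn (P : add_cone) x n : P x -> (0 < n)%N -> P (x *+ n).
Proof.
case: n => // n Px _; elim: n => [//|n IHn].
by rewrite mulrS; apply: coneD.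
Qed.

Definition cone_le (P Q : add_cone) : bool := `[< forall x, P x -> Q x >].

Lemma add_cone_eq (P Q : add_cone) : (P : V -> Prop) = Q -> P = Q.
Proof.
case: P Q => [P P0 PD] [Q Q0 QD] /= e; case: _ / e in Q0 QD *.
by congr AddCone; apply: Prop_irrelevance.
Qed.

Lemma maximal_cone :
  exists P : add_cone, forall Q : add_cone, (forall x, P x -> Q x) -> forall x, Q x -> P x.
Proof.
have [|P Q S /asboolP PQ /asboolP QS|P Q /asboolP PQ /asboolP QP|C Ctot|P Pmax] :=
  @classical_sets.Zorn add_cone cone_le.
- by move=> P; apply/asboolP.
- by apply/asboolP => x /PQ/QS.
- by apply: add_cone_eq; apply/funext => x; apply/propext; split=> [/PQ|/QP].
- (* the union of a chain of cones is a cone; for the empty chain it is empty *)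
  have U0 : ~ (exists2 P, C P & (P : add_cone) 0) by case=> P _ /cone0.
  have UD x y : (exists2 P, C P & (P : add_cone) x) ->
      (exists2 P, C P & (P : add_cone) y) -> exists2 P, C P & (P : add_cone) (x + y).
    move=> [P CP Px] [Q CQ Qy].
    case: (Ctot _ _ CP CQ) => /asboolP PQ.
      by exists Q => //; apply: coneD => //; apply: PQ.
    by exists P => //; apply: coneD => //; apply: PQ.
  by exists (AddCone U0 UD) => P CP; apply/asboolP => x Px; exists P.
- exists P => Q PQ x Qx; rewrite -(Pmax Q) //; exact/asboolP.
Qed.

(** Otherwise P and x generate a larger cone. *)
Lemma maximal_cone_out (P : add_cone) x : torsion_free V ->
  (forall Q : add_cone, (forall x, P x -> Q x) -> forall x, Q x -> P x) ->
  x <> 0 -> ~ P x -> exists2 n, (0 < n)%N & P (- x *+ n).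
Proof.
move=> Vtf Pmax x0 Px.
pose Q y := exists p n, [/\ y = p + x *+ n, p = 0 \/ P p & P p \/ (0 < n)%N].
case: (pselect (Q 0)) => [[p [n [e p0 pn]]]|Q0].
  have ep : p = - x *+ n by apply/eqP; rewrite mulNrn -addr_eq0 -e.
  case: p0 => [p0|Pp].
    case: pn => [Pp|n0]; first by case: (@cone0 P); rewrite -p0.
    by case: x0; apply: (Vtf _ n n0); rewrite e p0 add0r.
  exists n; last by rewrite -ep.
  by case: n ep {e pn} => // ep; case: (@cone0 P); rewrite -[0](mulr0n (- x)) -ep.
have QD y z : Q y -> Q z -> Q (y + z).
  move=> [p [n [-> p0 pn]]] [q [m [-> q0 qm]]].
  exists (p + q), (n + m)%N; split; first by rewrite mulrnDr addrACA.
    case: p0 q0 => [->|Pp] [->|Pq]; rewrite ?addr0 ?add0r; [by left|by right..|].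
    by right; apply: coneD.
  case: pn => [Pp|n0]; last by right; rewrite addn_gt0 n0.
  case: q0 => [->|Pq]; first by left; rewrite addr0.
  by left; apply: coneD.
case: Px; apply: (Pmax (AddCone Q0 QD)) => [y Py|].
  by exists y, 0%N; rewrite mulr0n addr0; split=> //; [right | left].
by exists 0, 1%N; rewrite mulr1n add0r; split=> //; [left | right].
Qed.

(** If neither x nor - x is in a maximal cone P, then P contains - n x and
    m x with n, m > 0, hence 0 = m (- n x) + n (m x). *)
Lemma torsion_free_cone : torsion_free V ->
  exists P : add_cone, forall x, [\/ x = 0, P x | P (- x)].
Proof.
move=> Vtf; have [P Pmax] := maximal_cone; exists P => x.
have [->|/eqP x0] := eqVneq x 0; first by constructor 1.
case: (pselect (P x)) => Px; first by constructor 2.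
case: (pselect (P (- x))) => PNx; first by constructor 3.
have [n n0 Pn] := maximal_cone_out Vtf Pmax x0 Px.
have Nx0 : - x <> 0 by move/eqP; rewrite oppr_eq0 => /eqP.
have [m m0 Pm] := maximal_cone_out Vtf Pmax Nx0 PNx.
case: (@cone0 P); rewrite opprK in Pm.
have := coneD (coneMn Pn m0) (coneMn Pm n0).
by rewrite -!mulrnA mulnC mulNrn addNr.
Qed.

End OrderTorsionFree.

(** * Left orders on groups *)

Section PositiveCones.
Local Open Scope group_scope.

Record positive_cone (L : groupType) (P : L -> Prop) := PositiveCone {
  pos1 : ~ P 1;
  posM : forall x y, P x -> P y -> P (x * y);
  pos_total : forall x, [\/ x = 1, P x | P x^-1] }.

Lemma positive_cone_left_orderable (L : groupType) (P : L -> Prop) :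
  positive_cone P -> left_orderable L.
Proof.
move=> Ppos; exists (fun x y => `[< P (x^-1 * y) >]); split.
- by move=> x; apply/asboolP; rewrite mulVg; apply: pos1 Ppos.
- move=> y x z /asboolP xy /asboolP yz; apply/asboolP.
  by have := posM Ppos xy yz; rewrite !gnorm.
- move=> x y xy; apply/orP.
  have [/mulg1_eq e|Pxy|Pyx] := pos_total Ppos (x^-1 * y).
  + by rewrite -e invgK eqxx in xy.
  + by left; apply/asboolP.
  + by right; apply/asboolP; rewrite invgM invgK in Pyx.
- by move=> h x y; rewrite invgM -mulgA mulKg.
Qed.

(** The lexicographic order of an extension.  The cone Q is only required to
    decide the elements of the kernel of f, and may extend beyond it. *)
Lemma positive_cone_extension (L M : groupType) (f : L -> M) (P : M -> Prop)
    (Q : L -> Prop) :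
  {morph f : x y / x * y} -> positive_cone P ->
  ~ Q 1 -> (forall x y, Q x -> Q y -> Q (x * y)) ->
  (forall x, f x = 1 -> [\/ x = 1, Q x | Q x^-1]) ->
  positive_cone (fun x => P (f x) \/ f x = 1 /\ Q x).
Proof.
move=> fM Ppos Q1 QM Qtot; split.
- by rewrite (hom1 fM) => -[/(pos1 Ppos)|[]].
- move=> x y [Px|[fx Qx]] [Py|[fy Qy]]; rewrite fM.
  + by left; apply: posM.
  + by left; rewrite fy mulg1.
  + by left; rewrite fx mul1g.
  + by right; rewrite fx fy mulg1; split=> //; apply: QM.
- move=> x; rewrite (homV fM).
  have [fx|Px|Px] := pos_total Ppos (f x).
  + have [->|Qx|Qx] := Qtot x fx; first by constructor 1.
      by constructor 2; right.
    by constructor 3; right; rewrite fx invg1.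
  + by constructor 2; left.
  + by constructor 3; left.
Qed.

End PositiveCones.

(** * The left-ordered central extension of a circular order *)

Section CircularCocycle.
Variables (G : groupType) (c : G -> G -> G -> int).
Hypothesis c_vals : forall g1 g2 g3, c g1 g2 g3 \in [:: -1; 0; 1].
Hypothesis c_eq0 :
  forall g1 g2 g3, c g1 g2 g3 = 0 <-> [\/ g1 = g2, g1 = g3 | g2 = g3].
Hypothesis c_coc : forall g1 g2 g3 g4,
  c g2 g3 g4 - c g1 g3 g4 + c g1 g2 g4 - c g1 g2 g3 = 0.
Hypothesis c_inv :
  forall h g1 g2 g3, c g1 g2 g3 = c (h * g1)%g (h * g2)%g (h * g3)%g.

(** The classical nonnegative representative of the circular class.  For G a
    group of rotations, it is the carry when the angles of g and h, taken in
    one turn, are added. *)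
Definition carry (g h : G) : int :=
  if (g == 1%g) || (h == 1%g) then 0 else
  if (g * h == 1)%g then 1 else (c 1%g g (g * h)%g == -1)%:Z.

(** Twice carry is the inhomogeneous cocycle of - c plus the coboundary of the
    indicator function of g <> 1; the cocycle identity of carry follows by
    halving. *)
Lemma carry_double g h :
  carry g h + carry g h = (g != 1%g)%:Z + (h != 1%g)%:Z - (g * h != 1)%g%:Z
                   - c 1%g g (g * h)%g.
Proof.
rewrite /carry; have [->|g1] := eqVneq g 1%g.
  have -> : c 1%g 1%g (1 * h)%g = 0 by apply/c_eq0; constructor 1.
  by rewrite mul1g; case: (h == 1%g).
have [->|h1] := eqVneq h 1%g.
  have -> : c 1%g g (g * 1)%g = 0 by apply/c_eq0; constructor 3; rewrite mulg1.
  by rewrite mulg1 (negPf g1).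
have [->|gh1] := eqVneq (g * h)%g 1%g.
  have -> : c 1%g g 1%g = 0 by apply/c_eq0; constructor 2.
  by [].
have c0 : c 1%g g (g * h)%g <> 0.
  move/c_eq0=> [e|e|e].
  - by rewrite e eqxx in g1.
  - by rewrite -e eqxx in gh1.
  - by move: h1; rewrite -(inj_eq (mulgI g)) -e mulg1 eqxx.
have := c_vals 1%g g (g * h)%g; rewrite !inE => /or3P[/eqP->|/eqP//|/eqP->] //.
Qed.

Lemma carryP g h k :
  carry g h + carry (g * h)%g k = carry h k + carry g (h * k)%g.
Proof.
have e1 := carry_double g h; have e2 := carry_double (g * h)%g k.
have e3 := carry_double h k; have e4 := carry_double g (h * k)%g.
have e := c_coc 1%g g (g * h)%g (g * h * k)%g.
have i := c_inv g 1%g h (h * k)%g; rewrite mulg1 in i.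
rewrite !mulgA in i e1 e2 e3 e4 *; rewrite -i in e.
move: (carry _ _) (carry _ _) (carry _ _) (carry _ _) e e1 e2 e3 e4 {i}.
move: (c _ _ _) (c _ _ _) (c _ _ _) (c _ _ _) => a1 a2 a3 a4.
move: (_ != _)%:Z (_ != _)%:Z (_ != _)%:Z (_ != _)%:Z (_ != _)%:Z (_ != _)%:Z.
lia.
Qed.

Definition circ_cocycle : cocycle G int := Cocycle carryP.

Lemma carry_ge0 g h : 0 <= carry g h.
Proof. by rewrite /carry; do 2 case: ifP => // _. Qed.

Lemma carry1g g : carry 1%g g = 0.
Proof. by rewrite /carry eqxx. Qed.

Lemma carryVg g : g != 1%g -> carry g^-1%g g = 1.
Proof. by move=> g1; rewrite /carry invg_eq1 (negPf g1) mulVg eqxx. Qed.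

(** If g <> 1 then (m, g)^-1 = (- m - 1, g^-1), so exactly one of the two has a
    nonnegative first coordinate. *)
Lemma circ_ext_cone :
  positive_cone (fun x : twisted circ_cocycle => 0 <= x.1 /\ x <> 1%g).
Proof.
have oneE : (1%g : twisted circ_cocycle) = (0, 1%g).
  by rewrite tw_oneE /= carry1g.
split.
- by case.
- move=> [m g] [n h] /= [m0 x1] [n0 y1]; have c0 := carry_ge0 g h.
  split; first by lia.
  rewrite oneE => -[e gh].
  have [m_0 [n_0 cgh]] : m = 0 /\ n = 0 /\ carry g h = 0.
    by move: (carry g h) e c0 => z e z0; lia.
  have [g1|g1] := eqVneq g 1%g; first by case: x1; rewrite oneE m_0 g1.
  have gV : g = (h^-1)%g by apply/eqP; rewrite -mulg_eq1 gh.
  move: cgh; rewrite gV carryVg //.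
  by apply: contraNneq g1 => h1; rewrite gV h1 invg1.
- move=> [m g]; have [m0|m0] := Num.Theory.lerP 0 m.
    have [e|/eqP x1] := eqVneq ((m, g) : twisted circ_cocycle) 1%g.
      by constructor 1.
    by constructor 2.
  constructor 3; split; last first.
    move/eqP; rewrite invg_eq1 oneE => /eqP[e _].
    by rewrite e in m0.
  rewrite [(_^-1)%g]/(tw_inv _) /= carry1g.
  have [->|g1] := eqVneq g 1%g; first by rewrite invg1 carry1g; lia.
  by rewrite carryVg //; lia.
Qed.

End CircularCocycle.

Lemma circular_central_extension (G : groupType) : circularly_orderable G ->
  exists c : cocycle G int, exists P : twisted c -> Prop, positive_cone P.
Proof.
move=> [c [cv c0 cc ci]]; exists (circ_cocycle cv c0 cc ci).
by eexists; apply: circ_ext_cone.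
Qed.

Theorem theorem3p6 (G : groupType)
  (Gcirc : circularly_orderable G)
  (H1free : fg_free_abelian (H1 G))
  (H2tf : torsion_free (H2 G)) :
  left_orderable (tensor_square G).
Proof.
have [c [P Ppos]] := circular_central_extension Gcirc.
have secK := @tw_secK _ _ c.
have [Q Qtot] := torsion_free_cone (tensor_kernel_torsion_free H1free H2tf).
apply: (positive_cone_left_orderable (L := tensor_pairing G)).
apply: (positive_cone_extension (Q := fun t => exists2 z, cker_val z = t & Q z)
  (comm_liftM secK) Ppos).
- by move=> [z z1 Qz]; case: (@cone0 _ Q); rewrite -(_ : z = 0) //; apply: val_inj.
- by move=> x y [z <- Qz] [w <- Qw]; exists (z + w) => //; apply: coneD.
- move=> x ux; have dx : bd x = 1%g.
    by rewrite -(bd_comm_lift secK) ux (hom1 (@cfunM _ _ (tw_proj c))).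
  pose z : cker (bd_central (tensor_pairing G)) :=
    @Cker _ _ (bd_central _) x (introT eqP dx).
  have [z0|Qz|Qz] := Qtot z.
  + by constructor 1; rewrite -[x]/(cker_val z) z0.
  + by constructor 2; exists z.
  + by constructor 3; exists (- z).
Qed.
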